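(* Let $w$ be a word over the alphabet $\{a,b\}$. The relation $\vdash^*_{\{w\}}$ is a well quasi-order on $L^{\epsilon}_{\vdash_{\{w\}}}$ if and only if $w$ is good.
   Context: For a word $u$ and a letter $c$, $|u|_c$ is the number of occurrences of $c$ in $u$. For words $u,v$, the shuffle $u \sqcup\!\sqcup v$ is the set of all words $u_1v_1u_2v_2\cdots u_kv_k$ with $k\ge 1$, $u=u_1\cdots u_k$, $v=v_1\cdots v_k$ (the $u_i,v_i$ possibly empty). For a finite set $I$ of words, $v \vdash_I w$ means $w \in v \sqcup\!\sqcup u$ for some $u\in I$; $\vdash_I^*$ is the reflexive and transitive closure of $\vdash_I$, and $L^{\epsilon}_{\vdash_I}=\{w : \epsilon \vdash_I^* w\}$, where $\epsilon$ is the empty word. A quasi-order $\le$ on a set $S$ is a well quasi-order (wqo) iff for every infinite sequence $s_1,s_2,\dots$ of elements of $S$ there are $i<j$ with $s_i\le s_j$. Let $E$ be the morphism exchanging $a$ and $b$, and $\tilde w$ the mirror image (reversal) of $w$. A word $w$ over $\{a,b\}$ is bad if one of $w,\tilde w,E(w),E(\tilde w)$ has a factor of the form $a^kb^h$ with $k,h\ge 2$, or of the form $a^kba^lb^m$ with $k>l\ge 1$, $m\ge1$; $w$ is good if it is not bad. *)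

(* Defs.v *)
From mathcomp Require Import all_boot.
From Stdlib Require Import Relations.Relation_Operators.
Set Implicit Arguments. Unset Strict Implicit. Unset Printing Implicit Defensive.

Inductive letter : Type := a | b.
Definition word := seq letter.

Inductive shuffle : word -> word -> word -> Prop :=
  | shuffle_nil : shuffle [::] [::] [::]
  | shuffle_left  x u v w : shuffle u v w -> shuffle (x :: u) v (x :: w)
  | shuffle_right x u v w : shuffle u v w -> shuffle u (x :: v) (x :: w).

Definition step (I : word -> Prop) (v w : word) : Prop :=
  exists u, I u /\ shuffle v u w.

Definition derives (I : word -> Prop) : word -> word -> Prop :=
  clos_refl_trans word (step I).

Definition L_eps (I : word -> Prop) (w : word) : Prop := derives I [::] w.

Definition wqo_on (S : word -> Prop) (le : word -> word -> Prop) : Prop :=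
  (forall x, S x -> le x x) /\
  (forall x y z, S x -> S y -> S z -> le x y -> le y z -> le x z) /\
  (forall s : nat -> word, (forall n, S (s n)) ->
     exists i j, (i < j)%N /\ le (s i) (s j)).

Definition swap_letter (c : letter) : letter := if c is a then b else a.
Definition E (w : word) : word := map swap_letter w.

Definition factor (f w : word) : Prop := exists p s, w = p ++ f ++ s.

Definition has_bad_factor (w : word) : Prop :=
  (exists k h, (2 <= k)%N /\ (2 <= h)%N /\ factor (nseq k a ++ nseq h b) w) \/
  (exists k l m, (l < k)%N /\ (1 <= l)%N /\ (1 <= m)%N /\
     factor (nseq k a ++ [:: b] ++ nseq l a ++ nseq m b) w).

Definition bad (w : word) : Prop :=
  has_bad_factor w \/ has_bad_factor (rev w) \/
  has_bad_factor (E w) \/ has_bad_factor (E (rev w)).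

Definition good (w : word) : Prop := ~ bad w.

(* Main.v *)
(* Write u <= v if v is a shuffle of u and of copies of w.

   If w = p f s contains a bad factor f with maximal outer runs, blow every letter of p and of s
   up n times and put a shuffle of n copies of f in between: each copy of w must use exactly the
   prefix p and the suffix s, so an antichain for f yields one for w.  For f = a^k b^h and
   f = a^k b a^l b^m the antichain is X S^q T, q = 0, 1, ..., where S cannot be torn apart:
   after X, and then after each S, one of the two words shuffled has not started, and the smaller
   word gets stuck where its own T begins.

   A good word is, up to exchanging a and b, a^q0 b a^q1 b ... b a^qk whose inner exponents
   dominate their neighbours.  Distributing the letters to the copies first-in first-out shows
   that the shuffles of N copies are the words whose path (number of b, number of a) stays, in
   each of k slabs of N letters b, between two lines, a floor and a ceiling.  Cut such a word into
   a bounded number of factors so short that in each of them one of the two lines is far away or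
   vacuous.  A factor constrained by one line is coded by a path returning to 0 and staying
   nonnegative, and such paths are well quasi-ordered by embeddings whose remainder is again such
   a path (Nash-Williams' minimal bad sequence).  The remainder then satisfies the near constraint
   for every factor, and also the far one if the larger word is much larger than the smaller. *)

Require Import Defs.
From HB Require Import structures.
From mathcomp Require Import all_boot zify.
From Stdlib Require Import Classical IndefiniteDescription.
From Stdlib Require Import Relations.Relation_Operators Relations.Operators_Properties.
Set Implicit Arguments. Unset Strict Implicit. Unset Printing Implicit Defensive.

(** * Shuffles *)

Definition bool_of_letter (c : letter) : bool := if c is a then true else false.
Definition letter_of_bool (x : bool) : letter := if x then a else b.

Lemma bool_of_letterK : cancel bool_of_letter letter_of_bool.
Proof. by case. Qed.

HB.instance Definition _ := Finite.copy letter (can_type bool_of_letterK).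

(** Polymorphic form of [shuffle]: coloured letters and code words are shuffled as well as words. *)
Inductive interleave (T : Type) : seq T -> seq T -> seq T -> Prop :=
  | InterleaveNil : interleave [::] [::] [::]
  | InterleaveL x u v w : interleave u v w -> interleave (x :: u) v (x :: w)
  | InterleaveR x u v w : interleave u v w -> interleave u (x :: v) (x :: w).

#[local] Hint Constructors interleave : core.

Section Interleave.
Variable T : Type.
Implicit Types u v w r s : seq T.

Lemma interleave0s u : interleave [::] u u.
Proof. by elim: u => [|x u IH]; constructor. Qed.

Lemma interleaves0 u : interleave u [::] u.
Proof. by elim: u => [|x u IH]; constructor. Qed.

Lemma interleave_sym u v w : interleave u v w -> interleave v u w.
Proof. by elim => *; constructor. Qed.

Lemma interleave_cat u1 r1 v1 u2 r2 v2 :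
  interleave u1 r1 v1 -> interleave u2 r2 v2 ->
  interleave (u1 ++ u2) (r1 ++ r2) (v1 ++ v2).
Proof. by move=> H1 H2; elim: H1 => //= *; constructor. Qed.

Lemma interleave_catl u v w s : interleave u v w -> interleave (s ++ u) v (s ++ w).
Proof. exact: interleave_cat (interleaves0 s). Qed.

Lemma interleave_catr u v w s : interleave u v w -> interleave u (s ++ v) (s ++ w).
Proof. exact: interleave_cat (interleave0s s). Qed.

Lemma interleave_cat_inv u r v1 v2 : interleave u r (v1 ++ v2) ->
  exists u1 u2 r1 r2, [/\ u = u1 ++ u2, r = r1 ++ r2,
    interleave u1 r1 v1 & interleave u2 r2 v2].
Proof.
elim: v1 u r => [|x v1 IH] u r /= H; first by exists [::], u, [::], r.
inversion H as [|y u' r' w' H'|y u' r' w' H']; subst.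
  have [u1 [u2 [r1 [r2 [-> -> H1 H2]]]]] := IH _ _ H'.
  by exists (x :: u1), u2, r1, r2; split => //; constructor.
have [u1 [u2 [r1 [r2 [-> -> H1 H2]]]]] := IH _ _ H'.
by exists u1, u2, (x :: r1), r2; split => //; constructor.
Qed.

Lemma interleave_splitr u r1 r2 v : interleave u (r1 ++ r2) v ->
  exists u1 u2 v1 v2, [/\ u = u1 ++ u2, v = v1 ++ v2,
    interleave u1 r1 v1 & interleave u2 r2 v2].
Proof.
move Er: (r1 ++ r2) => r H; elim: H r1 r2 Er => {u r v} [|x u r v H IH|x u r v H IH] r1 r2 Er.
- by case: r1 Er => [|//] /= ->; exists [::], [::], [::], [::].
- have [u1 [u2 [v1 [v2 [-> -> H1 H2]]]]] := IH _ _ Er.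
  by exists (x :: u1), u2, (x :: v1), v2; split => //; constructor.
case: r1 Er => [|y r1] /= Er.
  by exists [::], u, [::], (x :: v); split => //; rewrite Er; constructor.
case: Er => -> /IH [u1 [u2 [v1 [v2 [-> -> H1 H2]]]]].
by exists u1, u2, (x :: v1), v2; split => //; constructor.
Qed.

Lemma interleave_assoc u r v s w : interleave u r v -> interleave v s w ->
  exists2 t, interleave r s t & interleave u t w.
Proof.
move=> H1 H2; elim: H2 u r H1 => {v s w} [|x v s w H2 IH|x v s w H2 IH] u r H1.
- by inversion H1; exists [::].
- inversion H1 as [|y u' r' w' H'|y u' r' w' H']; subst;
    have [t Ht Hu] := IH _ _ H'.
    by exists t => //; constructor.
  by exists (x :: t); constructor.
have [t Ht Hu] := IH _ _ H1.
by exists (x :: t); constructor.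
Qed.

Lemma interleave_assoc_r u r s t w : interleave r s t -> interleave u t w ->
  exists2 v, interleave u r v & interleave v s w.
Proof.
move=> /interleave_sym H1 /interleave_sym H2.
have [v H3 H4] := interleave_assoc H1 H2.
by exists v; apply: interleave_sym.
Qed.

Lemma interleave_rev u v w : interleave u v w -> interleave (rev u) (rev v) (rev w).
Proof.
elim=> {u v w} [|x u v w _ IH|x u v w _ IH] //; rewrite !rev_cons -!cats1.
- rewrite -[rev v]cats0; apply: interleave_cat => //; exact: interleaves0.
- rewrite -[rev u]cats0; apply: interleave_cat => //; exact: interleave0s.
Qed.

Lemma interleave_map (U : Type) (f : T -> U) u v w :
  interleave u v w -> interleave (map f u) (map f v) (map f w).
Proof. by elim => *; constructor. Qed.

Lemma interleave_pmap (U : Type) (f : T -> option U) u v w :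
  interleave u v w -> interleave (pmap f u) (pmap f v) (pmap f w).
Proof. by elim=> //= x {}u {}v {}w _; case: (f x) => //= *; constructor. Qed.

Lemma interleave_count (P : pred T) u v w :
  interleave u v w -> count P w = count P u + count P v.
Proof. by elim=> //= x {}u {}v {}w _ ->; lia. Qed.

Lemma interleave_size u v w : interleave u v w -> size w = size u + size v.
Proof. by move=> /(interleave_count predT); rewrite !count_predT. Qed.

Lemma interleave_filter (P : pred T) u : interleave (filter P u) (filter (predC P) u) u.
Proof. by elim: u => //= x u IH; case: (P x) => /=; constructor. Qed.

Lemma interleave_eq u r v : interleave u r v -> size v = size u -> u = v.
Proof.
move=> H Hs; have := interleave_size H; rewrite Hs => Hr.
have {Hr} /size0nil Er : size r = 0 by lia.
rewrite {}Er {Hs} in H; move Es: [::] H => s H.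
by elim: H Es => // x {}u {}r {}v _ IH /IH ->.
Qed.

End Interleave.

Lemma interleave_subseql (T : eqType) (u v w : seq T) : interleave u v w -> subseq u w.
Proof.
elim => {u v w} //= [x u v w _ IH|x u v w _ IH]; first by rewrite eqxx.
exact: subseq_trans IH (subseq_cons _ _).
Qed.

Lemma interleave_subseqr (T : eqType) (u v w : seq T) : interleave u v w -> subseq v w.
Proof. by move/interleave_sym/interleave_subseql. Qed.

Lemma interleave_nseq (T : eqType) (x : T) n u v : interleave u v (nseq n x) ->
  exists i j, [/\ u = nseq i x, v = nseq j x & i + j = n].
Proof.
move=> H; exists (size u), (size v); split.
- apply/all_pred1P/allP => y Hy; have := mem_subseq (interleave_subseql H) Hy.
  by rewrite mem_nseq => /andP [].
- apply/all_pred1P/allP => y Hy; have := mem_subseq (interleave_subseqr H) Hy.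
  by rewrite mem_nseq => /andP [].
- by rewrite -(interleave_size H) size_nseq.
Qed.

Lemma shuffleE u v w : shuffle u v w <-> interleave u v w.
Proof. by split; elim => *; constructor. Qed.

(** * Shuffles of copies of one word *)

Inductive copies (w : word) : nat -> word -> Prop :=
  | Copies0 : copies w 0 [::]
  | CopiesS n u v : copies w n u -> interleave u w v -> copies w n.+1 v.

Definition copies_le (w u v : word) : Prop :=
  exists r n, copies w n r /\ interleave u r v.

Definition well_copied (w : word) : Prop :=
  forall s : nat -> word, (forall n, exists m, copies w m (s n)) ->
    exists i j, i < j /\ copies_le w (s i) (s j).

(** By associativity, copies inserted one after the other can first be shuffled among themselves
    into a single remainder [r]. *)
Lemma derivesP w u v : derives (fun x => x = w) u v <-> copies_le w u v.
Proof.
split.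
  move=> /clos_rt_rtn1_iff; elim => [|x y [_ [-> /shuffleE Hs]] _ [r [n [Hr Hi]]]].
    by exists [::], 0; split; [constructor|apply: interleaves0].
  have [t Ht Hu] := interleave_assoc Hi Hs.
  by exists t, n.+1; split => //; apply: CopiesS Ht.
case=> r [n [Hr]]; elim: Hr v => {n r} [|n r t Hr IH Ht] v Hv.
  rewrite (interleave_eq Hv); last by rewrite (interleave_size Hv) addn0.
  exact: rt_refl.
have [x Hx Hxv] := interleave_assoc_r Ht Hv.
apply: rt_trans (IH _ Hx) (rt_step _ _ _ _ _).
by exists w; split => //; apply/shuffleE.
Qed.

Lemma L_epsP w v : L_eps (fun x => x = w) v <-> exists n, copies w n v.
Proof.
rewrite /L_eps derivesP; split=> [[r [n [Hr Hi]]]|[n Hn]].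
  exists n; suff -> : v = r by [].
  by apply/esym/(interleave_eq (interleave_sym Hi)); rewrite (interleave_size Hi) add0n.
by exists v, n; split => //; apply: interleave0s.
Qed.

Lemma wqo_onP w :
  wqo_on (L_eps (fun u => u = w)) (derives (fun u => u = w)) <-> well_copied w.
Proof.
split=> [[_ [_ H]] s Hs|H].
  have [|i [j [ij /derivesP Hij]]] := H s; last by exists i, j.
  by move=> n; apply/L_epsP.
split; first by move=> x _; apply: rt_refl.
split; first by move=> x y z _ _ _; apply: rt_trans.
move=> s Hs; have [|i [j [ij Hij]]] := H s; first by move=> n; apply/L_epsP.
by exists i, j; split => //; apply/derivesP.
Qed.

Lemma copies_size w n v : copies w n v -> size v = n * size w.
Proof. by elim=> //= {}n u {}v _ IH /interleave_size ->; rewrite IH; lia. Qed.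

Lemma copies_count (P : pred letter) w n v : copies w n v -> count P v = n * count P w.
Proof. by elim=> //= {}n u {}v _ IH /(interleave_count P) ->; rewrite IH; lia. Qed.

Lemma copies_cat w1 w2 n v1 v2 :
  copies w1 n v1 -> copies w2 n v2 -> copies (w1 ++ w2) n (v1 ++ v2).
Proof.
move=> H1; elim: H1 v2 => [|{}n u v H IH Hv] v2 H2; inversion H2; subst.
  exact: Copies0.
by apply: CopiesS (IH _ _) _; last apply: interleave_cat; eassumption.
Qed.

(** Induction principle for invariants of partly read shuffles: a prefix of a shuffle of copies is a
    shuffle of one prefix [p] of [w] per copy. *)
Lemma copies_prefix (w : word) (V : nat -> word -> Prop) : V 0 [::] ->
  (forall n u p q v, V n u -> w = p ++ q -> interleave u p v -> V n.+1 v) ->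
  forall n v1 v2, copies w n (v1 ++ v2) -> V n v1.
Proof.
move=> V0 VS n v1 v2; move Ev: (v1 ++ v2) => v H.
elim: H v1 v2 Ev => {n v} [|n u v _ IH Hv] v1 v2 Ev; first by case: v1 Ev.
rewrite -Ev in Hv; have [u1 [u2 [p [q [Eu Ew H1 H2]]]]] := interleave_cat_inv Hv.
exact: VS (IH _ _ (esym Eu)) Ew H1.
Qed.

Lemma copies_involution (F : word -> word) w n v :
  (forall x y z, interleave x y z -> interleave (F x) (F y) (F z)) -> F [::] = [::] ->
  copies w n v -> copies (F w) n (F v).
Proof.
move=> HF F0; elim=> [|{}n u {}v _ IH H]; first by rewrite F0; constructor.
by apply: CopiesS IH _; apply: HF.
Qed.

Lemma well_copied_involution (F : word -> word) w : involutive F ->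
  (forall x y z, interleave x y z -> interleave (F x) (F y) (F z)) -> F [::] = [::] ->
  well_copied w -> well_copied (F w).
Proof.
move=> FK HF F0 H s Hs; have [n|i [j [ij [r [n [Hr Hi]]]]]] := H (F \o s).
  have [m Hm] := Hs n; exists m; rewrite -[w]FK /=.
  exact: copies_involution Hm.
exists i, j; split => //; exists (F r), n; split; first exact: copies_involution.
by rewrite -(FK (s i)) -(FK (s j)); apply: HF.
Qed.

Lemma E_involutive : involutive E.
Proof. by move=> w; rewrite /E -map_comp map_id_in //; case. Qed.

Lemma well_copied_rev w : well_copied w -> well_copied (rev w).
Proof.
apply: well_copied_involution => //; [exact: revK | exact: interleave_rev].
Qed.

Lemma well_copied_E w : well_copied w -> well_copied (E w).
Proof.
apply: well_copied_involution => //; [exact: E_involutive | exact: interleave_map].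
Qed.

Definition na (w : word) : nat := count_mem a w.
Definition nb (w : word) : nat := count_mem b w.

Arguments na : simpl never.
Arguments nb : simpl never.

Lemma na_cat u v : na (u ++ v) = na u + na v. Proof. exact: count_cat. Qed.
Lemma nb_cat u v : nb (u ++ v) = nb u + nb v. Proof. exact: count_cat. Qed.
Lemma na_cons c v : na (c :: v) = (c == a) + na v. Proof. by []. Qed.
Lemma nb_cons c v : nb (c :: v) = (c == b) + nb v. Proof. by []. Qed.
Lemma na_nseq n c : na (nseq n c) = (c == a) * n. Proof. exact: count_nseq. Qed.
Lemma nb_nseq n c : nb (nseq n c) = (c == b) * n. Proof. exact: count_nseq. Qed.
Lemma na_flatten_nseq q s : na (flatten (nseq q s)) = q * na s.
Proof. by elim: q => //= q IH; rewrite na_cat IH. Qed.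
Lemma nb_flatten_nseq q s : nb (flatten (nseq q s)) = q * nb s.
Proof. by elim: q => //= q IH; rewrite nb_cat IH. Qed.

Lemma na_nil : na [::] = 0. Proof. by []. Qed.
Lemma nb_nil : nb [::] = 0. Proof. by []. Qed.

Definition countE := (na_cat, nb_cat, na_cons, nb_cons, na_nseq, nb_nseq, na_flatten_nseq,
  nb_flatten_nseq, na_nil, nb_nil, eqxx, mul1n).

Lemma eq_ab : (a == b) = false. Proof. by []. Qed.
Lemma eq_ba : (b == a) = false. Proof. by []. Qed.
Definition lettersE := (countE, eq_ab, eq_ba, mul0n, add0n, addn0, muln0).

Lemma interleave_na u r v : interleave u r v -> na v = na u + na r.
Proof. exact: interleave_count. Qed.
Lemma interleave_nb u r v : interleave u r v -> nb v = nb u + nb r.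
Proof. exact: interleave_count. Qed.

Lemma copies_na w n v : copies w n v -> na v = n * na w.
Proof. exact: copies_count. Qed.
Lemma copies_nb w n v : copies w n v -> nb v = n * nb w.
Proof. exact: copies_count. Qed.

Lemma size_na_nb (w : word) : size w = na w + nb w.
Proof. by elim: w => //= c w ->; rewrite !countE; case: c => /=; lia. Qed.

(** * Bad words *)

Definition blow_up n (w : word) : word := flatten [seq nseq n c | c <- w].

Lemma size_blow_up n w : size (blow_up n w) = n * size w.
Proof. by elim: w => [|c w IH] /=; rewrite ?muln0 // size_cat size_nseq IH; lia. Qed.

Lemma rev_blow_up n w : rev (blow_up n w) = blow_up n (rev w).
Proof.
rewrite /blow_up rev_flatten map_rev -map_comp; congr (flatten (rev _)).
by apply: eq_map => c /=; rewrite rev_nseq.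
Qed.

Lemma copies_blow_up n w : copies w n (blow_up n w).
Proof.
elim: n => [|n IH].
  rewrite (_ : blow_up 0 w = [::]); first exact: Copies0.
  by apply: size0nil; rewrite size_blow_up.
apply: CopiesS IH _; elim: w => [|c w IH]; first exact: InterleaveNil.
by apply: InterleaveR; apply: interleave_catl.
Qed.

(** Number of changes of letter in [c :: s]. Passing to a subsequence or blowing up cannot increase
    it, which limits how far a word can be read inside a blown-up prefix. *)
Fixpoint alternations (c : letter) (s : word) :=
  if s is x :: s' then (c != x) + alternations x s' else 0.

Lemma alternations_le c x s : alternations c s <= (c != x) + alternations x s.
Proof. by case: s => //= y s; case: c; case: x; case: y => /=; lia. Qed.

Lemma alternations_subseq c s t : subseq s t -> alternations c s <= alternations c t.
Proof.
elim: t c s => [|x t IH] c [|y s] //=; case: eqP => [->|_] Hs.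
  by rewrite leq_add2l IH.
exact: leq_trans (IH _ _ Hs) (alternations_le _ _ _).
Qed.

Lemma alternations_blow_up n c w : alternations c (blow_up n w) <= alternations c w.
Proof.
elim: w c => //= x w IH c; apply: (@leq_trans ((c != x) + alternations x (blow_up n w))).
  have Er m r : alternations x (nseq m x ++ r) = alternations x r.
    by elim: m => //= m ->; rewrite eqxx.
  by apply: leq_trans (alternations_le _ x _) _; rewrite /blow_up /= Er.
by rewrite leq_add2l.
Qed.

Lemma alternations_rcons c p d :
  alternations c (rcons p d) = alternations c p + (last c p != d).
Proof. by elim: p c => [|x p IH] c /=; rewrite ?addn0 // IH addnA. Qed.

(** The cut between [p] and [s] does not split a run of equal letters; vacuous if either word is
    empty. *)
Definition boundary (p s : word) := forall p' c s', p = rcons p' c -> s <> c :: s'.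

(** A longer [x] would contain [p] and the next letter, which starts a new run: one alternation more
    than [blow_up n p] allows. *)
Lemma prefix_in_blow_up n p s x y : boundary p s -> p ++ s = x ++ y ->
  subseq x (blow_up n p) -> size x <= size p.
Proof.
move=> Hb E Hx; rewrite leqNgt; apply/negP => Hlt.
have Ex : x = p ++ take (size x - size p) s.
  by rewrite -[LHS](take_size_cat y (erefl (size x))) -E take_cat ltnNge (ltnW Hlt).
case Es : s => [|d s1] in Hb E Ex.
  by have := congr1 size E; rewrite !size_cat /=; lia.
have Hsub : subseq (rcons p d) (blow_up n p).
  apply: subseq_trans Hx; rewrite Ex -cats1; apply: cat_subseq => //.
  have: 0 < size x - size p by lia.
  by case: (size x - size p) => //= k _; rewrite eqxx sub0seq.
case: p Hb {E Hx Hlt Ex} Hsub => [|c p] Hb Hsub; first by rewrite subseq0 in Hsub.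
have := leq_trans (alternations_subseq c Hsub) (alternations_blow_up n c (c :: p)).
rewrite alternations_rcons; case: eqP => [El|_]; last by lia.
by case: (Hb (belast c p) d s1) => //; rewrite -El -lastI.
Qed.

(** Each copy places at most [size p] letters in [v1]; if the total is attained, each copy places
    exactly [p] there. The exponent [N] is independent of [n], as [v1] is embedded in the prefix of
    a larger word. *)
Lemma copies_blow_up_split p w N n v v1 v2 :
  boundary p w -> copies (p ++ w) n v -> v = v1 ++ v2 -> subseq v1 (blow_up N p) ->
  size v1 <= n * size p /\
  (size v1 = n * size p -> copies p n v1 /\ copies w n v2).
Proof.
move=> Hb H; elim: H v1 v2 => {n v} [|n u v Hu IH Hv] v1 v2 E Hs.
  have -> : v1 = [::] by case: v1 E {Hs}.
  have -> : v2 = [::] by case: v1 E {Hs} => //; case: v2.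
  by split => // _; split; apply: Copies0.
rewrite E in Hv; have [u1 [u2 [x1 [x2 [Eu Ex H1 H2]]]]] := interleave_cat_inv Hv.
have [|IH1 IH2] := IH u1 u2 Eu.
  exact: subseq_trans (interleave_subseql H1) Hs.
have Hx : size x1 <= size p.
  apply: (prefix_in_blow_up Hb Ex (n := N)).
  exact: subseq_trans (interleave_subseqr H1) Hs.
rewrite (interleave_size H1); split; first by lia.
move=> Heq; have [|Hp Hw] := IH2; first by lia.
have Hxp : size x1 = size p by lia.
have /eqP := Ex; rewrite eqseq_cat // => /andP [/eqP Ep /eqP Ew].
rewrite -Ep in H1; rewrite -Ew in H2.
by split; [apply: CopiesS Hp H1 | apply: CopiesS Hw H2].
Qed.

(* In a blown-up prefix every copy must consume exactly the prefix it blows up, so comparing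
   the long words amounts to comparing their middle parts. *)
Lemma copies_le_blow_up p f s N N' Z Z' :
  f <> [::] -> boundary p (f ++ s) -> boundary (rev s) (rev f) ->
  copies f N Z -> copies f N' Z' ->
  copies_le (p ++ f ++ s) (blow_up N' p ++ Z' ++ blow_up N' s)
    (blow_up N p ++ Z ++ blow_up N s) -> copies_le f Z' Z.
Proof.
move=> f0 Hp Hs HZ HZ' [r [n [Hr Hi]]].
set w := p ++ f ++ s in Hr.
have Hw : 0 < size w by rewrite !size_cat; case: (f) f0 => //= *; lia.
have Hcop M Y : copies f M Y -> copies w M (blow_up M p ++ Y ++ blow_up M s).
  by move=> HY; do 2?[apply: copies_cat => //]; apply: copies_blow_up.
have EN : N = N' + n.
  have := interleave_size Hi; rewrite (copies_size (Hcop _ _ HZ)).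
  rewrite (copies_size (Hcop _ _ HZ')) (copies_size Hr) -mulnDl => /eqP.
  by rewrite eqn_pmul2r // => /eqP.
have [u1 [u2 [r1 [r2 [Eu Er H1 H2]]]]] := interleave_cat_inv Hi.
have [Su1 Su2] := copies_blow_up_split Hp (Hcop _ _ HZ') Eu (interleave_subseql H1).
have [Sr1 Sr2] := copies_blow_up_split Hp Hr Er (interleave_subseqr H1).
(* The two sizes are bounded by the two summands of [(N' + n) * size p] and add up to it, so both
   bounds are attained. *)
have := interleave_size H1; rewrite size_blow_up EN mulnDl => Sz.
have [|_ Hu2] := Su2; first by lia.
have [|_ Hr2] := Sr2; first by lia.
have Eu2 : u2 = Z' ++ blow_up N' s.
  have Su : size (blow_up N' p) = size u1 by rewrite size_blow_up; lia.
  by have /eqP := Eu; rewrite eqseq_cat; [case/andP => _ /eqP <-|exact: Su].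
have [u3 [u4 [r3 [r4 [Eu' Er' H3 H4]]]]] := interleave_cat_inv H2.
(* After reversal the suffix [s] is handled as a prefix. *)
have Hrev M x : copies (f ++ s) M x -> copies (rev s ++ rev f) M (rev x).
  by rewrite -rev_cat; apply: copies_involution => //; apply: interleave_rev.
have Hsub x : subseq x (blow_up N s) -> subseq (rev x) (blow_up N (rev s)).
  by rewrite -rev_blow_up subseq_rev.
have Eu4 := congr1 rev Eu'; rewrite rev_cat in Eu4.
have Er4 := congr1 rev Er'; rewrite rev_cat in Er4.
have [Tu1 Tu2] := copies_blow_up_split Hs (Hrev _ _ Hu2) Eu4 (Hsub _ (interleave_subseql H4)).
have [Tr1 Tr2] := copies_blow_up_split Hs (Hrev _ _ Hr2) Er4 (Hsub _ (interleave_subseqr H4)).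
have := interleave_size H4; rewrite size_blow_up EN mulnDl.
rewrite !size_rev in Tu1 Tu2 Tr1 Tr2 => Sz4.
have [|_ Hr3] := Tr2; first by lia.
have Eu3 : u3 = Z'.
  have Su3 : size u3 = size Z'.
    by have := congr1 size Eu'; rewrite Eu2 !size_cat size_blow_up; lia.
  have /eqP := Eu'; rewrite Eu2 eqseq_cat //.
  by case/andP => /eqP <-.
rewrite -Eu3; exists r3, n; split => //.
rewrite -(revK f) -(revK r3).
by apply: copies_involution Hr3 => //; apply: interleave_rev.
Qed.

Lemma not_well_copied_factor p f s (N : nat -> nat) (Z : nat -> word) :
  f <> [::] -> boundary p (f ++ s) -> boundary (rev s) (rev f) ->
  (forall q, copies f (N q) (Z q)) ->
  (forall q' q, q' < q -> ~ copies_le f (Z q') (Z q)) ->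
  ~ well_copied (p ++ f ++ s).
Proof.
move=> f0 Hp Hs HZ Hanti Hw.
have [n|i [j [ij Hij]]] := Hw (fun q => blow_up (N q) p ++ Z q ++ blow_up (N q) s).
  by exists (N n); do 2?[apply: copies_cat => //]; apply: copies_blow_up.
exact: Hanti ij (copies_le_blow_up f0 Hp Hs (HZ j) (HZ i) Hij).
Qed.

(** * Antichains of pumped words *)

Definition pump (x s t : word) q : word := x ++ flatten (nseq q s) ++ t.

Lemma flatten_nseqSr (T : Type) (s : seq T) q :
  flatten (nseq q.+1 s) = flatten (nseq q s) ++ s.
Proof. by elim: q => [|q IH] /=; rewrite ?cats0 // -catA -IH. Qed.

(* Criterion for the words [x s^q t] to form an antichain: in a shuffle of [u = x s^q' t] with a
   remainder, either the remainder stays empty, and the two words advance in lockstep until [t]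
   meets [s] (step_t), or [u] stays empty for ever (step_idle) and does not fit into [t]. *)
Section Pump.
Variables (w x s t : word).
Definition part_of_copies (r : word) := exists r' n, copies w n (r ++ r').
Hypothesis x_neq0 : x <> [::].
Hypothesis step_x : forall q u1 u2 r, pump x s t q = u1 ++ u2 ->
  interleave u1 r x -> part_of_copies r -> u1 = [::] \/ r = [::].
Hypothesis step_s : forall y u1 u2 r, s ++ y = u1 ++ u2 ->
  interleave u1 r s -> part_of_copies r -> r = [::].
Hypothesis step_idle : forall c q u1 u2 r, pump x s t q = u1 ++ u2 ->
  interleave u1 r s -> part_of_copies (x ++ flatten (nseq c s) ++ r) -> u1 = [::].
Hypothesis step_t : forall u1 u2 r, t = u1 ++ u2 ->
  interleave u1 r s -> part_of_copies r -> False.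

Lemma part_of_copies_cat r r' : part_of_copies (r ++ r') -> part_of_copies r.
Proof. by case=> y [n]; rewrite -catA => H; exists (r' ++ y), n. Qed.

Lemma pump_idle u q c r k : pump x s t k = u -> c <= q ->
  part_of_copies r ->
  forall r2, r = x ++ flatten (nseq c s) ++ r2 ->
  interleave u r2 (flatten (nseq (q - c) s) ++ t) ->
  interleave u (drop (size (x ++ flatten (nseq q s))) r) t.
Proof.
move=> Eu; move Ed: (q - c) => d; elim: d c Ed => [|d IH] c Ed Hc Hr r2 Er H.
  have -> : q = c by lia.
  by rewrite Er catA drop_size_cat.
rewrite /= -catA in H.
have [u1 [u2 [r3 [r4 [E1 E2 H1 H2]]]]] := interleave_cat_inv H.
have Eu1 : u1 = [::].
  apply: (@step_idle c k u1 u2 r3) => //; first by rewrite Eu.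
  by apply: (@part_of_copies_cat _ r4); rewrite -!catA -E2 -Er.
rewrite Eu1 /= in E1 H1.
have Er3 : s = r3.
  have := interleave_size H1 => /= Hs.
  by apply/esym/(interleave_eq (interleave_sym H1)).
apply: (IH c.+1) => //; try lia; last by rewrite E1; exact: H2.
by rewrite Er E2 flatten_nseqSr -!catA Er3.
Qed.

(** As long as the remainder is empty the two words read equal factors [s]; the smaller one then
    reaches [t] while the larger still has an [s]. *)
Lemma pump_lockstep q' q r r2 : part_of_copies r -> r = r2 ->
  interleave (flatten (nseq q' s) ++ t) r2 (flatten (nseq q s) ++ t) ->
  q' < q -> False.
Proof.
elim: q' q r r2 => [|q' IH] [|q] r r2 Hr Er H // Hq.
  rewrite [flatten _ ++ t]/= -catA in H.
  have [u1 [u2 [r3 [r4 [E1 E2 H1 H2]]]]] := interleave_cat_inv H.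
  by apply: step_t E1 H1 _; apply: (@part_of_copies_cat _ r4); rewrite -E2 -Er.
rewrite /= -!catA in H.
have [u1 [u2 [r3 [r4 [E1 E2 H1 H2]]]]] := interleave_cat_inv H.
have Er3 : r3 = [::].
  by apply: step_s E1 H1 _; apply: (@part_of_copies_cat _ r4); rewrite -E2 -Er.
rewrite Er3 in H1 E2; have Eu1 : u1 = s.
  by apply: (interleave_eq H1); rewrite (interleave_size H1) addn0.
move: E1; rewrite Eu1 => /eqP; rewrite eqseq_cat // eqxx /= => /eqP E1.
by apply: (IH q r r4) => //; [rewrite Er E2|rewrite E1].
Qed.

Lemma pump_antichain q' q : q' < q -> ~ copies_le w (pump x s t q') (pump x s t q).
Proof.
move=> Hq [r [n [Hr Hi]]].
have Pr : part_of_copies r by exists [::], n; rewrite cats0.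
have [u1 [u2 [r1 [r2 [Eu Er H1 H2]]]]] := interleave_cat_inv Hi.
have [] := step_x Eu H1 _; first by apply: (@part_of_copies_cat _ r2); rewrite -Er.
  move=> Eu1; rewrite Eu1 in Eu H1.
  have Er1 : x = r1.
    by apply/esym/(interleave_eq (interleave_sym H1)); rewrite (interleave_size H1).
  (* This case is impossible by length: [u] would fit into [t], but it also contains the nonempty
     [x]. *)
  have := @pump_idle _ q 0 r q' Eu (leq0n q) Pr r2.
  rewrite /= subn0 {1}Er -Er1 => /(_ erefl H2) /interleave_size.
  rewrite -[u2]Eu !size_cat; case: (x) x_neq0 => //= *; lia.
move=> Er1; rewrite Er1 in Er H1.
have Ex : u1 = x.
  by apply: (interleave_eq H1); rewrite (interleave_size H1) addn0.
move: Eu; rewrite /pump Ex => /eqP; rewrite eqseq_cat // eqxx /= => /eqP E.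
by apply: pump_lockstep Pr Er _ Hq; rewrite E.
Qed.
End Pump.

Lemma nseqSr (T : Type) n (x : T) : nseq n.+1 x = nseq n x ++ [:: x].
Proof. by rewrite -addn1 nseqD. Qed.

Lemma prefix_nseq_cat n y u1 u2 : nseq n a ++ y = u1 ++ u2 ->
  na u1 < n -> u1 = nseq (na u1) a.
Proof.
elim: n u1 => [|n IH] [|c u1] //= [<- E]; rewrite na_cons eqxx => Hc.
by rewrite {1}(IH _ E).
Qed.

Lemma prefix_nseq_sep n p y s u2 : nseq n a ++ y = (nseq p a ++ b :: s) ++ u2 -> n <= p.
Proof.
rewrite leqNgt -cat_rcons -catA => E; apply/negP => Hp.
have := prefix_nseq_cat E; rewrite -cats1 !lettersE => /(_ Hp).
by move=> /(congr1 nb); rewrite !lettersE.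
Qed.

Lemma interleave_nseq_cat (c : letter) n s u r : interleave u r (nseq n c ++ s) ->
  exists i j u' r', [/\ u = nseq i c ++ u', r = nseq j c ++ r', i + j = n
    & interleave u' r' s].
Proof.
move=> /interleave_cat_inv [u1 [u2 [r1 [r2 [-> -> H1 H2]]]]].
by have [i [j [-> -> <-]]] := interleave_nseq H1; exists i, j, u2, r2.
Qed.

Lemma interleave_cons (c : letter) s u r : interleave u r (c :: s) ->
  (exists2 u', u = c :: u' & interleave u' r s) \/
  (exists2 r', r = c :: r' & interleave u r' s).
Proof. by move=> H; inversion H; subst; [left|right]; eexists. Qed.

Lemma nseq_nil (c : letter) n : n = 0 -> nseq n c = [::].
Proof. by move->. Qed.

Lemma interleave_word (u r v u' r' v' : word) :
  interleave u r v -> u = u' -> r = r' -> v = v' -> interleave u' r' v'.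
Proof. by move=> H <- <- <-. Qed.

Lemma copies1 w : copies w 1 w.
Proof. exact: CopiesS (Copies0 w) (interleave0s w). Qed.

(** * The antichain for a factor with two runs *)

Section TwoBlocks.
Variables k h : nat.
Hypotheses (k0 : 0 < k) (h0 : 0 < h).
Let w : word := nseq k.+1 a ++ nseq h.+1 b.
Let x : word := nseq (2 * k.+1) a ++ nseq (2 * h).+1 b.
Let s : word := nseq k a ++ [:: b; a] ++ nseq h b.
Let t : word := nseq k.+1 a ++ nseq h.+2 b.

(* Every copy that has consumed a letter b has consumed all its letters a. *)
Lemma two_blocks_valid r : part_of_copies w r ->
  exists n, nb r <= h.+1 * n /\ k.+1 * n <= na r.
Proof.
move=> [r' [n H]]; move: H; apply: (@copies_prefix w (fun _ r => exists n,
  nb r <= h.+1 * n /\ k.+1 * n <= na r)); first by exists 0; rewrite !muln0.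
move=> {}n u p q v [n' [H1 H2]] Ew Hv; rewrite (interleave_na Hv) (interleave_nb Hv).
have [Hp|Hp] := ltnP (na p) k.+1.
  exists n'; rewrite (prefix_nseq_cat Ew Hp) !lettersE; lia.
exists n'.+1; split; last by lia.
suff: nb p <= h.+1 by lia.
have := congr1 (nb) Ew; rewrite !lettersE; lia.
Qed.

Lemma two_blocks_first r : part_of_copies w r -> 0 < nb r -> k < na r.
Proof. by move=> /two_blocks_valid [[|n] [H1 H2]]; lia. Qed.

Lemma two_blocks_copies q : copies w q.+3 (pump x s t q).
Proof.
(* This is [pump x s t q] with one whole copy of [w] removed from [x]. *)
pose y q : word := nseq k.+1 a ++ nseq h b ++ flatten (nseq q s) ++ t.
have Hy : copies w q.+2 (y q).
  elim: q => [|q IH].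
    apply: CopiesS (copies1 w) _.
    apply: interleave_word (interleave_catl (nseq k.+1 a ++ nseq h b)
      (interleave_catr (nseq k.+1 a) (interleave_catl [:: b] (interleave0s (nseq h.+1 b))))) _ _ _.
    - by rewrite /w (nseqSr h) cats0 -catA.
    - by [].
    - by rewrite /y -!catA.
  (* The new copy keeps its last b until [k] letters a of the old word have passed; this creates one
     more [s]. *)
  apply: CopiesS IH _.
  apply: interleave_word (interleave_catr (nseq k.+1 a ++ nseq h b)
      (interleave_catl (nseq k a) (interleave_catr [:: b]
       (interleaves0 (a :: nseq h b ++ flatten (nseq q s) ++ t))))) _ _ _;
    by rewrite /w /y /s ?(nseqSr h) ?(nseqSr k) /= -?catA /=.
apply: CopiesS Hy _.
have Ek : 2 * k.+1 = k.+1 + k.+1 by lia.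
have Eh : (2 * h).+1 = h.+1 + h by lia.
apply: interleave_word (interleave_catl (nseq k.+1 a) (interleave_catr w
   (interleaves0 (nseq h b ++ flatten (nseq q s) ++ t)))) _ _ _.
- by [].
- by rewrite cats0.
- by rewrite /w /pump /x Ek Eh !nseqD -!catA.
Qed.

Lemma two_blocks_antichain q' q : q' < q -> ~ copies_le w (pump x s t q') (pump x s t q).
Proof.
apply: pump_antichain => //.
- move=> {}q u1 u2 r Eu /interleave_nseq_cat [p [p' [u1' [r' [Eu1 Er Ep H]]]]].
  have [z [z' [Eu1' Er' Ez]]] := interleave_nseq H.
  move=> /two_blocks_valid [n]; rewrite Er Er' !lettersE => [[Hn1 Hn2]].
  rewrite /pump -catA in Eu; have := prefix_nseq_cat Eu; rewrite Eu1 Eu1' !lettersE => Hu.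
  have [Hp|Hp] := ltnP p (2 * k.+1).
    left; have Hz : z = 0.
      have := congr1 (nb) (Hu _); rewrite !lettersE; apply; lia.
    (* The remainder has all the 2h+1 > h+1 letters b, so at least two copies have spent all their
       letters a, which are the 2(k+1) available. *)
    have Hn : 1 < n by rewrite ltnNge; apply/negP => Hn; case: n Hn Hn1 Hn2 => [|[|n]]; lia.
    have Hp0 : p = 0 by nia.
    by rewrite Hp0 Hz.
  right; have p'0 : p' = 0 by lia.
  have n0 : n = 0 by nia.
  have z'0 : z' = 0 by rewrite n0 in Hn1; lia.
  by rewrite p'0 z'0.
- move=> y u1 u2 r Eu /interleave_nseq_cat [p [p' [u1' [r' [Eu1 Er Ep H]]]]] Hr.
  case: (interleave_cons H) => [[u3 Eu3 H3]|[r3 Er3 H3]]; last first.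
    have := Hr; rewrite Er Er3 -cat1s catA => /part_of_copies_cat /two_blocks_first.
    by rewrite !lettersE; lia.
  have Hp : k <= p.
    by apply: (@prefix_nseq_sep _ _ _ u3 u2); rewrite -Eu3 -Eu1 -Eu /s -catA.
  have p'0 : p' = 0 by lia.
  have Epk : p = k by lia.
  rewrite p'0 /= in Er; rewrite Er.
  case: (interleave_cons H3) => [[u4 Eu4 H4]|[r4 Er4 H4]].
    have [z [z' [Eu5 Er5 Ez]]] := interleave_nseq H4.
    have := two_blocks_first Hr; rewrite Er Er5 !lettersE => Hz.
    by rewrite nseq_nil //; lia.
  (* If the remainder takes the lone a of [s], this does not pay for a letter b, so [u] would have
     to read b again where its next letter is a. *)
  have [z [z' [Eu5 Er5 Ez]]] := interleave_nseq H4.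
  have := two_blocks_first Hr; rewrite Er Er4 Er5 !lettersE => Hz.
  have Ezh : z = h by lia.
  have := Eu; rewrite /s Eu1 Eu3 Eu5 Epk Ezh -!catA => /eqP.
  by rewrite eqseq_cat // eqxx /=; case: (h) h0.
- move=> c {}q u1 u2 r Eu H /two_blocks_valid [n].
  have := interleave_na H; have := interleave_nb H.
  rewrite /s /x !lettersE => Hb Ha [Hn1 Hn2].
  rewrite /pump -catA in Eu; have Hu := prefix_nseq_cat Eu.
  rewrite Hu; last by lia.
  have Hb0 : nb u1 = 0 by rewrite Hu ?lettersE; lia.
  (* As h >= 1, the 2h+1 + (c+1)(h+1) letters b exceed (c+2)(h+1); hence c+3 copies have spent their
     letters a, and these are all the letters a read. *)
  have Hn : c + 3 <= n by nia.
  by rewrite nseq_nil //; nia.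
(* The first b of [s] comes after only [k] letters a: too early for [u], which starts with [k.+1] of
   them, and for the remainder alike. *)
move=> u1 u2 r Eu /interleave_nseq_cat [p [p' [u1' [r' [Eu1 Er Ep H]]]]] Hr.
case: (interleave_cons H) => [[u3 Eu3 H3]|[r3 Er3 H3]].
  suff: k.+1 <= p by lia.
  by apply: (@prefix_nseq_sep _ _ _ u3 u2); rewrite -Eu3 -Eu1 -Eu.
have := Hr; rewrite Er Er3 -cat1s catA => /part_of_copies_cat /two_blocks_first.
by rewrite !lettersE; lia.
Qed.
End TwoBlocks.

Lemma nseq_cat_prefix n (c : letter) y u1 u2 : nseq n c ++ y = u1 ++ u2 -> n <= size u1 ->
  exists2 u, u1 = nseq n c ++ u & y = u ++ u2.
Proof.
elim: n u1 => [|n IH] [|d u1] //=; [by move=> <-; exists [::] | by exists (d :: u1) |].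
by move=> [<- E] /IH [] // u -> ->; exists u.
Qed.

Lemma cat_cancel (T : Type) (s u v : seq T) : s ++ u = s ++ v -> u = v.
Proof. by elim: s => //= x s IH [/IH]. Qed.

Lemma no_descent p j : ~~ subseq [:: b; a] (nseq p a ++ nseq j b).
Proof. by elim: p => //=; case: j => //= j; elim: j. Qed.

(** * The antichain for a factor with four runs *)

Section FourBlocks.
Variables k l m : nat.
Hypotheses (lk : l < k) (l0 : 0 < l) (m0 : 0 < m).
Let w : word := nseq k a ++ b :: nseq l a ++ nseq m b.
Let x : word := nseq (2 * k) a ++ nseq 2 b ++ nseq l a ++ nseq m b.
Let s : word := nseq (k + l) a ++ nseq m.+1 b.
Let t : word := nseq (2 * k + l) a ++ nseq m.+1 b ++ nseq l a ++ nseq m b ++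
  b :: nseq l a ++ nseq m b.

Lemma four_blocks_prefix p q : w = p ++ q ->
  (p = nseq (na p) a /\ nb p = 0) \/
  (k <= na p /\ nb p <= 1) \/ (k + l <= na p /\ nb p <= m.+1).
Proof.
move=> Ew; have [Hp|Hp] := ltnP (na p) k.
  by left; rewrite (prefix_nseq_cat Ew Hp) !lettersE.
right; have [p1 Ep Ew1] : exists2 p', p = nseq k a ++ p' & b :: nseq l a ++ nseq m b = p' ++ q.
  by apply: nseq_cat_prefix Ew _; rewrite size_na_nb; lia.
case: p1 Ep Ew1 => [|c p2] Ep Ew1; first by left; rewrite Ep !lettersE; lia.
case: Ew1 Ep => <- Ew2 Ep.
have [Hp2|Hp2] := ltnP (na p2) l.
  by left; rewrite Ep (prefix_nseq_cat Ew2 Hp2) !lettersE; lia.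
right; rewrite Ep !lettersE; have := congr1 nb Ew2; rewrite !lettersE; lia.
Qed.

(* [i] counts the copies having consumed one letter b, and [j] those having consumed more. *)
Lemma four_blocks_valid r : part_of_copies w r ->
  exists i j, nb r <= i + m.+1 * j /\ k * i + (k + l) * j <= na r.
Proof.
move=> [r' [n H]]; move: H; apply: (@copies_prefix w (fun _ r => exists i j,
  nb r <= i + m.+1 * j /\ k * i + (k + l) * j <= na r)); first by exists 0, 0; rewrite !muln0.
move=> {}n u p q v [i [j [H1 H2]]] Ew Hv; rewrite (interleave_na Hv) (interleave_nb Hv).
have [[_ Hp]|[[Hp1 Hp2]|[Hp1 Hp2]]] := four_blocks_prefix Ew.
- by exists i, j; lia.
- by exists i.+1, j; lia.
- by exists i, j.+1; lia.
Qed.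

(* As the first two letters b of [w] are separated, each letter b of the ascent uses its own copy. *)
Lemma four_blocks_valid_ascent i j y : part_of_copies w (nseq i a ++ nseq j b ++ y) ->
  k * j <= i.
Proof.
rewrite catA => /part_of_copies_cat [r' [n H]].
suff: ~~ subseq [:: b; a] (nseq i a ++ nseq j b) ->
  k * nb (nseq i a ++ nseq j b) <= na (nseq i a ++ nseq j b).
  by rewrite !lettersE; apply; apply: no_descent.
move: H; apply: (@copies_prefix w (fun _ r => ~~ subseq [:: b; a] r -> k * nb r <= na r)).
  by rewrite muln0.
move=> {r' y i j}n u p q v IH Ew Hv Hs; rewrite (interleave_na Hv) (interleave_nb Hv).
have Hsu := contra (fun H => subseq_trans H (interleave_subseql Hv)) Hs.
have Hsp := contra (fun H => subseq_trans H (interleave_subseqr Hv)) Hs.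
have {IH} := IH Hsu; suff: k * nb p <= na p by lia.
have [Hp|Hp] := ltnP (na p) k; first by rewrite (prefix_nseq_cat Ew Hp) !lettersE.
have [p1 Ep Ew1] : exists2 p', p = nseq k a ++ p' & b :: nseq l a ++ nseq m b = p' ++ q.
  by apply: nseq_cat_prefix Ew _; rewrite size_na_nb; lia.
case: p1 Ep Ew1 => [|c p2] Ep Ew1; first by rewrite Ep !lettersE.
case: Ew1 Ep => <- Ew2 Ep; case: p2 Ew2 Ep => [|d p3] Ew2 Ep; first by rewrite Ep !lettersE; lia.
have Ed : d = a by case: (l) l0 Ew2 => //= l' _ [].
case/negP: Hsp; rewrite Ep Ed.
apply: (subseq_trans _ (suffix_subseq _ _)).
by rewrite /= sub0seq.
Qed.

Lemma four_blocks_copies q : copies w (q + 4) (pump x s t q).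
Proof.
have Ek : 2 * k = k + k by lia.
pose z : word := nseq k a ++ w ++ b :: nseq l a ++ nseq m b.
have Hz : copies w 2 z.
  apply: CopiesS (copies1 w) _.
  apply: interleave_word (interleave_catl (nseq k a) (interleave_catr w
    (interleaves0 (b :: nseq l a ++ nseq m b)))) _ _ _ => //.
  by rewrite cats0.
pose y q : word := nseq k a ++ [:: b] ++ flatten (nseq q s) ++ t.
have Hy : copies w (q + 3) (y q).
  elim: q => [|q IH].
    apply: CopiesS Hz _.
    apply: interleave_word (interleave_catr (nseq k a ++ b :: nseq l a)
      (interleave_catl (nseq (k + k) a) (interleave_catr (nseq m b)
       (interleaves0 ([:: b] ++ nseq l a ++ nseq m b ++ b :: nseq l a ++ nseq m b))))) _ _ _.
    - by rewrite /z /w nseqD -!catA /= -?catA.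
    - by rewrite /w cats0 -!catA.
    - by rewrite /y /t Ek (addnC (k + k)) !nseqD (nseqSr m) -!catA /= -?catA.
  (* The new copy holds back its last run until the first [k] letters a of the old word have passed;
     this creates one more [s]. *)
  apply: CopiesS IH _.
  apply: interleave_word (interleave_catr (nseq k a ++ b :: nseq l a)
      (interleave_catl (nseq k a) (interleave_catr (nseq m b)
       (interleaves0 ([:: b] ++ flatten (nseq q s) ++ t))))) _ _ _.
  - by [].
  - by rewrite /w cats0 -!catA.
  - by rewrite /y -[flatten (nseq q.+1 s)]/(s ++ flatten (nseq q s)) {2}/s (addnC k) nseqD (nseqSr m) -!catA /= -?catA.
rewrite (addnS q 3); apply: CopiesS Hy _.
apply: interleave_word (interleave_catl (nseq k a) (interleave_catr (nseq k a ++ [:: b])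
  (interleave_catl [:: b] (interleave_catr (nseq l a ++ nseq m b)
   (interleaves0 (flatten (nseq q s) ++ t)))))) _ _ _.
- by [].
- by rewrite /w cats0 -!catA.
- by rewrite /pump /x Ek nseqD -!catA.
Qed.

(** Cost argument: a first b costs [k] letters a, and all [m.+1] letters b of a copy cost k+l. Since
    m+1 >= 2 and l < k, the cheapest c(m+1)+1 letters b come from [c] full copies and one first b,
    for c(k+l)+k letters a; then [p] extra ones do not fit. *)
Lemma four_blocks_tight c i j p : c * m.+1 + 1 <= i + m.+1 * j ->
  k * i + (k + l) * j + p <= c * (k + l) + k -> p = 0.
Proof.
move=> H1 H2; have [Hj|Hj] := ltnP c j.
  have : (k + l) * c.+1 <= (k + l) * j by rewrite leq_mul2l; lia.
  by lia.
have [d Ed] : exists d, c = j + d by exists (c - j); lia.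
have Hi : d * 2 + 1 <= i.
  have : m.+1 * c = m.+1 * j + m.+1 * d by rewrite Ed mulnDr.
  have : 2 * d <= m.+1 * d by rewrite leq_mul2r; lia.
  by lia.
have : k * (d * 2 + 1) <= k * i by rewrite leq_mul2l Hi orbT.
have : (k + l) * c = (k + l) * j + (k + l) * d by rewrite Ed mulnDr.
have : l * d <= k * d by rewrite leq_mul2r; lia.
by lia.
Qed.

Lemma four_blocks_antichain q' q : q' < q -> ~ copies_le w (pump x s t q') (pump x s t q).
Proof.
(* As m >= 1 and l < k, the k+l letters a of [s] cannot pay for its m+1 letters b at [k] each. *)
have Hkm i : i <= k + l -> ~ k * m.+1 <= i.
  move=> Hi; suff: k * 2 <= k * m.+1 by lia.
  by rewrite leq_mul2l; lia.
apply: pump_antichain.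
- by rewrite /x; case: (k) lk.
- move=> {}q u1 u2 r Eu /interleave_nseq_cat [p [p' [u3 [r3 [Eu1 Er Ep H]]]]].
  case: (interleave_nseq_cat H) => [z [z' [u4 [r4 [Eu3 Er3 Ez H4]]]]].
  case: (interleave_nseq_cat H4) => [p2 [p2' [u5 [r5 [Eu4 Er4 Ep2 H5]]]]].
  have [z2 [z2' [Eu5 Er5 Ez2]]] := interleave_nseq H5 => Hr.
  have Eu' := Eu; rewrite /pump /x -!catA in Eu'.
  have [Hp|Hp] := ltnP p (2 * k).
    have Hz : z = 0.
      rewrite Eu1 Eu3 -!catA [RHS]catA in Eu'; have := prefix_nseq_cat Eu'.
      by rewrite !lettersE => /(_ Hp) /(congr1 nb); rewrite !lettersE.
    have Hz' : z' = 2 by lia.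
    have Hp0 : p = 0.
      by have := Hr; rewrite Er Er3 => /four_blocks_valid_ascent; lia.
    have Hz2 : z2 = 0.
      have := prefix_nseq_cat Eu'; rewrite Eu1 Eu3 Eu4 Eu5 Hp0 Hz !lettersE => Hn.
      by have := congr1 nb (Hn _); rewrite !lettersE; apply; lia.
    (* The remainder has read all m+2 letters b, whose least cost 2k+l uses up every letter a of
       [x]. *)
    have [i [j []]] := four_blocks_valid Hr.
    rewrite Er Er3 Er4 Er5 !lettersE => H6 H7.
    have Hp2 : p2 = 0 by apply: (@four_blocks_tight 1 i j); lia.
    by left; rewrite Eu1 Eu3 Eu4 Eu5 Hp0 Hz Hp2 Hz2.
  have Hp' : p' = 0 by lia.
  have Epk : p = 2 * k by lia.
  have Hz' : z' = 0.
    by have := Hr; rewrite Er Er3 Hp' => /four_blocks_valid_ascent; nia.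
  have Ez' : z = 2 by lia.
  have E2 : nseq l a ++ nseq m b ++ flatten (nseq q s) ++ t = u4 ++ u2.
    move: Eu'; rewrite Eu1 Eu3 Epk Ez' -!catA.
    by move=> /cat_cancel /cat_cancel.
  rewrite Eu4 Eu5 in E2; rewrite Er Er3 Hp' Hz' Er4 Er5 /= in Hr *.
  have Hr2 : part_of_copies w (nseq p2' a ++ nseq z2' b ++ [::]) by rewrite cats0.
  have := four_blocks_valid_ascent Hr2.
  have [Hl|Hl] := ltnP p2 l.
    have := prefix_nseq_cat E2; rewrite !lettersE => /(_ Hl) /(congr1 nb).
    rewrite !lettersE => Hz2.
    have Ezm : z2' = m by lia.
    have : k * 1 <= k * z2' by rewrite leq_mul2l; lia.
    by lia.
  have Hp2 : p2' = 0 by lia.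
  rewrite Hp2 => Hz2; right; have -> : z2' = 0 by nia.
  by [].
- move=> y u1 u2 r Eu /interleave_nseq_cat [p [p' [u3 [r3 [Eu1 Er Ep H]]]]].
  have [z [z' [Eu3 Er3 Ez]]] := interleave_nseq H => Hr.
  rewrite Er Er3 in Hr *.
  have Hr2 : part_of_copies w (nseq p' a ++ nseq z' b ++ [::]) by rewrite cats0.
  have := four_blocks_valid_ascent Hr2.
  rewrite /s -catA Eu1 Eu3 in Eu.
  have [Hl|Hl] := ltnP p (k + l).
    have := prefix_nseq_cat Eu; rewrite !lettersE => /(_ Hl) /(congr1 nb).
    rewrite !lettersE => Hz2.
    have -> : z' = m.+1 by lia.
    by move=> /Hkm; case; lia.
  have -> : p' = 0 by lia.
  move=> Hz2; have -> : z' = 0 by nia.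
  by [].
- move=> c {}q u1 u2 r Eu H /four_blocks_valid [i [j []]].
  have := interleave_na H; have := interleave_nb H.
  rewrite /s /x !lettersE => Hb Ha H1 H2.
  rewrite /pump /x -!catA in Eu; have Hu := prefix_nseq_cat Eu.
  rewrite Hu; last by lia.
  have Hb0 : nb u1 = 0 by rewrite Hu ?lettersE; lia.
  by rewrite (@four_blocks_tight (c + 2) i j (na u1)) //; lia.
move=> u1 u2 r Eu /interleave_nseq_cat [p [p' [u3 [r3 [Eu1 Er Ep H]]]]].
have [z [z' [Eu3 Er3 Ez]]] := interleave_nseq H => Hr.
have Hr2 : part_of_copies w (nseq p' a ++ nseq z' b ++ [::]) by rewrite cats0 -Er3 -Er.
have := four_blocks_valid_ascent Hr2.
have := prefix_nseq_cat Eu; rewrite Eu1 Eu3 !lettersE => Hn.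
have := congr1 nb (Hn _); rewrite !lettersE => Hz2.
have -> : z' = m.+1 by rewrite Hz2 in Ez; lia.
by move=> /Hkm; case; lia.
Qed.
End FourBlocks.

(** * From a bad factor to the whole word *)

Lemma trailing_letters (c : letter) (p : word) :
  exists e p', p = p' ++ nseq e c /\ forall q, p' <> rcons q c.
Proof.
elim/last_ind: p => [|p d [e [p' [-> Hp']]]].
  by exists 0, [::]; split => // -[].
have [->|Hd] := eqVneq d c; first by exists e.+1, p'; rewrite nseqSr catA cats1.
exists 0, (rcons (p' ++ nseq e c) d); rewrite cats0; split => // q.
by move/rcons_inj => [_ E]; rewrite E eqxx in Hd.
Qed.

Lemma leading_letters (c : letter) (s : word) :
  exists e s', s = nseq e c ++ s' /\ forall q, s' <> c :: q.
Proof.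
have [e [p [E Hp]]] := trailing_letters c (rev s); exists e, (rev p); split.
  by rewrite -[s]revK E rev_cat rev_nseq.
by move=> q Eq; apply: (Hp (rev q)); rewrite -rev_cons -Eq revK.
Qed.

Lemma not_well_copied_maximal p f s (N : nat -> nat) (Z : nat -> word) :
  (forall q, p <> rcons q a) -> (forall q, s <> b :: q) ->
  (exists f', f = a :: f') -> (exists f', f = rcons f' b) ->
  (forall q, copies f (N q) (Z q)) ->
  (forall q' q, q' < q -> ~ copies_le f (Z q') (Z q)) ->
  ~ well_copied (p ++ f ++ s).
Proof.
move=> Hp Hs [f1 E1] [f2 E2]; apply: not_well_copied_factor; first by rewrite E1.
- by move=> p' c s' Ep; rewrite E1 => -[Ec _]; apply: (Hp p'); rewrite Ep Ec.
- move=> p' c s' Es; rewrite E2 rev_rcons => -[Ec _].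
  by apply: (Hs (rev p')); rewrite -[s]revK Es rev_rcons Ec.
Qed.

Lemma has_bad_factor_not_well_copied w : has_bad_factor w -> ~ well_copied w.
Proof.
case=> [[k [h [k2 [h2 [p [s ->]]]]]]|[k [l [m [lk [l1 [m1 [p [s ->]]]]]]]]];
  (* The neighbouring letters a on the left and b on the right are absorbed, so that the outer runs
     become maximal; the inequalities on the exponents survive. *)
  have [e [p' [-> Hp]]] := trailing_letters a p;
  have [f [s' [-> Hs]]] := leading_letters b s.
- have Ek : e + k = (e + k).-1.+1 by lia.
  have Eh : h + f = (h + f).-1.+1 by lia.
  rewrite (_ : _ ++ _ = p' ++ (nseq (e + k) a ++ nseq (h + f) b) ++ s'); last first.
    by rewrite !nseqD -!catA.
  have Hk : 0 < (e + k).-1 by lia.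
  have Hh : 0 < (h + f).-1 by lia.
  rewrite Ek Eh; apply: (not_well_copied_maximal Hp Hs _ _ (two_blocks_copies Hk Hh)
    (two_blocks_antichain Hk Hh)); first by eexists.
  by eexists; rewrite (nseqSr (h + f).-1) catA cats1.
rewrite (_ : _ ++ _ = p' ++ (nseq (e + k) a ++ b :: nseq l a ++ nseq (m + f) b) ++ s');
  last by rewrite !nseqD -!catA /= -!catA.
have Hk : l < e + k by lia.
have Hm : 0 < m + f by lia.
apply: (not_well_copied_maximal Hp Hs _ _ (four_blocks_copies Hk l1 Hm)
  (four_blocks_antichain Hk l1 Hm)).
- by case: (e + k) Hk => // n _; eexists.
have -> : m + f = (m + f).-1.+1 by lia.
by eexists; rewrite (nseqSr (m + f).-1) -cat_cons !catA cats1.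
Qed.

Lemma bad_not_well_copied w : bad w -> ~ well_copied w.
Proof.
case=> [|[|[|]]] /has_bad_factor_not_well_copied H Hw; apply: H => //.
- exact: well_copied_rev.
- exact: well_copied_E.
- exact/well_copied_E/well_copied_rev.
Qed.

(** * Well quasi-orders *)

Section WellQuasiOrders.
Variables (X : Type) (S : X -> Prop) (R : X -> X -> Prop).

Definition good_pairs := forall f : nat -> X, (forall n, S (f n)) ->
  exists i j, i < j /\ R (f i) (f j).

(** This stronger form passes to products by extracting twice, without transitivity of [R]. *)
Definition increasing_subsequences := forall f : nat -> X, (forall n, S (f n)) ->
  exists g : nat -> nat, (forall i j, i < j -> g i < g j) /\
    forall i j, i < j -> R (f (g i)) (f (g j)).

Lemma increasing_subsequences_weaken : increasing_subsequences -> good_pairs.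
Proof.
move=> H f /H [g [g1 g2]]; exists (g 0), (g 1); split; [exact: g1|exact: g2].
Qed.

Lemma step_homo (Y : Type) (r : Y -> Y -> Prop) (g : nat -> Y) :
  (forall x y z, r x y -> r y z -> r x z) -> (forall i, r (g i) (g i.+1)) ->
  forall i j, i < j -> r (g i) (g j).
Proof.
move=> rt rS i j; elim: j => // j IH; rewrite ltnS leq_eqVlt => /orP [/eqP -> //|/IH H].
exact: rt H (rS j).
Qed.

(** If terms without a later larger term occurred arbitrarily far, they would form a sequence
    without good pair. So from some [N] on every term has a later larger one, and successors can be
    iterated. *)
Lemma good_pairs_subsequences : (forall x y z, R x y -> R y z -> R x z) ->
  good_pairs -> increasing_subsequences.
Proof.
move=> Rt H f Sf.
have [N HN] : exists N, forall n, N <= n -> exists m, n < m /\ R (f n) (f m).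
  apply: NNPP => HN.
  have [h Hh] : exists h, forall N, N <= h N /\ forall m, h N < m -> ~ R (f (h N)) (f m).
    apply: (functional_choice (fun N n => N <= n /\ forall m, n < m -> ~ R (f n) (f m))).
    move=> N; apply: NNPP => HN'; apply: HN; exists N => n Nn.
    apply: NNPP => Hn; apply: HN'; exists n; split => // m nm Rnm.
    by apply: Hn; exists m.
  pose g := fix g n := if n is n'.+1 then h (g n').+1 else h 0.
  have gS i : g i < g i.+1 by have [] := Hh (g i).+1.
  have gm := step_homo (r := fun x y => x < y) (fun x y z => @ltn_trans y x z) gS.
  have [i [j [ij Rij]]] := H (f \o g) (fun n => Sf _).
  have := gm _ _ ij; case: i Rij {ij} => [|i] Rij ij.
    by have [_ Hb] := Hh 0; apply: Hb Rij.
  by have [_ Hb] := Hh (g i).+1; apply: Hb Rij.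
(* A total choice function is needed; 0 is a default value below [N]. *)
have [h Hh] := functional_choice (fun n m => N <= n -> n < m /\ R (f n) (f m))
  (fun n => match classic (N <= n) with
    | or_introl Nn => let: ex_intro m Hm := HN n Nn in ex_intro _ m (fun _ => Hm)
    | or_intror Nn => ex_intro _ 0 (fun Nn' => False_ind _ (Nn Nn')) end).
pose g := fix g n := if n is n'.+1 then h (g n') else N.
have gN n : N <= g n.
  elim: n => [|n IH]; first exact: leqnn.
  by have [Hn _] := Hh _ IH; apply: leq_trans IH (ltnW Hn).
exists g; split.
  apply: (step_homo (r := fun x y => x < y)) => [x y z|i]; first exact: ltn_trans.
  by case: (Hh _ (gN i)).
apply: (step_homo (g := f \o g)) => [x y z|i]; first exact: Rt.
by case: (Hh _ (gN i)).
Qed.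

Lemma least_nat (P : nat -> Prop) n : P n -> exists m, P m /\ forall k, P k -> m <= k.
Proof.
elim/ltn_ind: n => n IH Pn; case: (classic (exists2 m, m < n & P m)) => [[m mn Pm]|H].
  exact: IH mn Pm.
exists n; split => // k Pk; rewrite leqNgt; apply/negP => kn; apply: H.
by exists k.
Qed.

Definition bad_sequence (f : nat -> X) :=
  (forall n, S (f n)) /\ forall i j, i < j -> ~ R (f i) (f j).

(** [F (n, f)] keeps the first [n] terms of [f] and minimises the measure of the next one among bad
    sequences; iterating it for n = 0, 1, ... and taking the diagonal gives [f]. *)
Lemma minimal_bad_sequence (mu : X -> nat) f0 : bad_sequence f0 ->
  exists f, bad_sequence f /\ forall n g, bad_sequence g ->
    (forall i, i < n -> g i = f i) -> mu (f n) <= mu (g n).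
Proof.
move=> Hf0.
have [F HF] : exists F : nat * (nat -> X) -> nat -> X, forall p, bad_sequence p.2 ->
  [/\ bad_sequence (F p), forall i, i < p.1 -> F p i = p.2 i
    & forall g, bad_sequence g -> (forall i, i < p.1 -> g i = p.2 i) ->
      mu (F p p.1) <= mu (g p.1)].
  apply: (functional_choice (fun p f => bad_sequence p.2 -> [/\ bad_sequence f,
    forall i, i < p.1 -> f i = p.2 i & forall g, bad_sequence g ->
    (forall i, i < p.1 -> g i = p.2 i) -> mu (f p.1) <= mu (g p.1)])).
  move=> [n f] /=; case: (classic (bad_sequence f)) => [Hf|Hf]; last by exists f.
  have [|m [[g [Hg Eg <-]] Hm]] := @least_nat (fun m => exists g,
    [/\ bad_sequence g, forall i, i < n -> g i = f i & mu (g n) = m]) (mu (f n)).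
    by exists f.
  exists g => _; split => // h Hh Eh; apply: Hm; by exists h.
pose G := fix G n := F (n, if n is n'.+1 then G n' else f0).
have GB n : bad_sequence (G n).
  elim: n => [|n IH] /=; first by case: (HF (0, f0) Hf0).
  by case: (HF (n.+1, G n) IH).
have GS n i : i <= n -> G n.+1 i = G n i.
  by move=> Hi; case: (HF (n.+1, G n) (GB n)) => _ + _; apply.
have Gd i d : G (i + d) i = G i i.
  by elim: d => [|d IH]; rewrite ?addn0 // addnS GS ?leq_addr.
have Ge i n : i <= n -> G n i = G i i by move=> Hi; rewrite -(subnKC Hi) Gd.
exists (fun n => G n n); split.
  split=> [n|i j ij]; first by case: (GB n).
  by rewrite -(Ge i j) 1?ltnW //; case: (GB j) => _; apply.
case=> [|n] g Hg Eg; first by case: (HF (0, f0) Hf0) => _ _; apply.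
case: (HF (n.+1, G n) (GB n)) => _ _; apply => // i Hi.
by rewrite /= Ge // Eg.
Qed.

End WellQuasiOrders.

Lemma increasing_subsequences_fin (T : finType) :
  increasing_subsequences (fun _ : T => True) eq.
Proof.
apply: good_pairs_subsequences => [x y z -> //|f _].
have /injectivePn [i [j ij Eij]] : ~~ injectiveb (fun i : 'I_#|T|.+1 => f i).
  by apply/negP => /injectiveP /leq_card; rewrite card_ord ltnn.
have [lt|lt|/val_inj E] := ltngtP i j; last by rewrite E eqxx in ij.
  by exists i, j.
by exists j, i.
Qed.

Lemma increasing_subsequences_pair X Y (S : X -> Prop) R (S' : Y -> Prop) R' :
  increasing_subsequences S R -> increasing_subsequences S' R' ->
  increasing_subsequences (fun p => S p.1 /\ S' p.2) (fun p q => R p.1 q.1 /\ R' p.2 q.2).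
Proof.
move=> H H' f Sf; have [g [g1 g2]] := H (fun n => (f n).1) (fun n => proj1 (Sf n)).
have [h [h1 h2]] := H' (fun n => (f (g n)).2) (fun n => proj2 (Sf (g n))).
exists (g \o h); split=> i j ij /=; first by apply/g1/h1.
by split; [apply/g2/h1 | apply: h2].
Qed.

Fixpoint forall1 X (S : X -> Prop) (s : seq X) : Prop :=
  if s is x :: s' then S x /\ forall1 S s' else True.

Fixpoint forall2 X Y (R : X -> Y -> Prop) (s : seq X) (t : seq Y) : Prop :=
  match s, t with
  | [::], [::] => True
  | x :: s', y :: t' => R x y /\ forall2 R s' t'
  | _, _ => False
  end.

Lemma increasing_subsequences_seq X (S : X -> Prop) R n : increasing_subsequences S R ->
  increasing_subsequences (fun s => size s = n /\ forall1 S s) (forall2 R).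
Proof.
move=> H; elim: n => [|n IH] f Sf.
  exists id; split => // i j _.
  by have [+ _] := Sf i; have [+ _] := Sf j => /= /size0nil -> /size0nil ->.
have [h Eh] : exists h : nat -> X * seq X, forall m, f m = (h m).1 :: (h m).2.
  apply: (functional_choice (fun m p => f m = p.1 :: p.2)) => m.
  by have [] := Sf m; case: (f m) => // x s _ _; exists (x, s).
have [|g [g1 g2]] := increasing_subsequences_pair H IH (f := h).
  by move=> m; have := Sf m; rewrite Eh /= => -[[]] ? [].
by exists g; split => // i j ij; rewrite !Eh /=; apply: g2.
Qed.

(** * Lukasiewicz paths *)

Section Lukasiewicz.
Variables (T : finType) (wt : T -> nat).
Implicit Types (x y u v r : seq T) (h : nat).

(* Heights of a path in which the letter [t] moves by [wt t - 1] : the path starts at height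
   [h], stays nonnegative and ends at height 0. *)
Fixpoint returns h x : bool :=
  if x is t :: x' then (0 < h + wt t) && returns (h + wt t).-1 x' else h == 0.

Definition returns_le x y := exists2 r, returns 0 r & interleave x r y.

Lemma returns_cat e h v y : returns e v -> returns (e + h) (v ++ y) = returns h y.
Proof.
elim: v e => [|t v IH] e /=; first by move=> /eqP ->.
move=> /andP [He /IH <-]; rewrite (_ : 0 < _); last by lia.
by congr returns; lia.
Qed.

Lemma returns_interleave e h u v x :
  interleave u v x -> returns e u -> returns h v -> returns (e + h) x.
Proof.
move=> H; elim: H e h => {u v x} [|t u v x _ IH|t u v x _ IH] e h /=.
- by move=> /eqP -> /eqP ->.
- move=> /andP [He Hu] Hv; have := IH _ _ Hu Hv.
  rewrite (_ : (e + wt t).-1 + h = (e + h + wt t).-1); last by lia.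
  by move=> ->; rewrite andbT; lia.
- move=> Hu /andP [He Hv]; have := IH _ _ Hu Hv.
  rewrite (_ : e + (h + wt t).-1 = (e + h + wt t).-1); last by lia.
  by move=> ->; rewrite andbT; lia.
Qed.

Lemma returns_remove h u v y : returns 0 v -> returns h (u ++ v ++ y) -> returns h (u ++ y).
Proof.
move=> Hv; elim: u h => [|t u IH] h /=; first by rewrite -{1}[h]add0n returns_cat.
by case/andP => -> /IH ->.
Qed.

Lemma returns_le_trans x y z : returns_le x y -> returns_le y z -> returns_le x z.
Proof.
move=> [r Hr Hxy] [s Hs Hyz]; have [t Ht Hxz] := interleave_assoc Hxy Hyz.
by exists t => //; apply: returns_interleave Ht Hr Hs.
Qed.

(** When [block_ok] holds, each pair is a first passage one level down: an excursion, then the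
    descending letter that closes it. *)
Definition blocks (ps : seq (seq T * T)) : seq T := flatten [seq rcons p.1 p.2 | p <- ps].
Definition block_ok (p : seq T * T) := returns 0 p.1 && (wt p.2 == 0).

Lemma returns_blocks ps h y : all block_ok ps ->
  returns (size ps + h) (blocks ps ++ y) = returns h y.
Proof.
elim: ps => //= -[v t] ps IH /andP [/andP [/= Hv /eqP Ht] /IH <-].
by rewrite /blocks /= -catA cat_rcons -{1}[_ + h]add0n returns_cat //= Ht addn0.
Qed.

(** Cut at the first passages through the next [n] lower levels. If the first letter descends, it is
    a block by itself; if it climbs by [e], it absorbs the first [e.+1] blocks of the rest. *)
Lemma returns_split n h x : returns (n + h) x -> exists ps y,
  [/\ size ps = n, all block_ok ps, x = blocks ps ++ y & returns h y].
Proof.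
have [m] := ubnP (size x); elim: m n h x => // m IH [|n] h [|t x] //=.
- by move=> _ Hh; exists [::], [::].
- by move=> _ Hh; exists [::], (t :: x).
rewrite ltnS => Hm.
case Ht : (wt t) => [|e] Hx.
  have [|ps [y [Sp Hp Ex Hy]]] := IH n h x Hm.
    by move: Hx; rewrite addn0.
  by exists (([::], t) :: ps), y; split; rewrite /= ?Sp ?Ex /block_ok ?Ht.
have [|ps [y [Sp Hp Ex Hy]]] := IH (e + n.+1) h x Hm.
  by move: Hx; congr returns; lia.
have Hn : e < size ps by rewrite Sp; lia.
case Ed : (drop e ps) => [|[v c] ps2].
  by have := congr1 size Ed; rewrite size_drop /=; lia.
have Ep : ps = take e ps ++ (v, c) :: ps2 by rewrite -Ed cat_take_drop.
move: Hp; rewrite Ep all_cat /= => /and3P [H1 /andP [/= Hv Hc] H2].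
exists ((t :: blocks (take e ps) ++ v, c) :: ps2), y; split => //.
- by have := congr1 size Ed; rewrite size_drop /=; lia.
- rewrite /= H2 andbT /block_ok /= Hc Ht /= andbT.
  have := @returns_blocks _ 0 v H1; rewrite size_takel 1?ltnW // addn0 => ->.
  exact: Hv.
- rewrite Ex {1}Ep /blocks map_cat flatten_cat /= rcons_cat /= -!catA /=.
  by rewrite -!cats1 -!catA.
Qed.

(** View of a nonempty path as a tree: the root letter [t] leads to height [wt t - 1], whence [wt t]
    excursions follow, all but the last closed by a descent. Each child is paired with a letter, the
    last one with [t], so that entrywise comparison of the lists compares the paths. *)
Definition node x (l : seq (seq T * T)) := exists t ps y,
  [/\ l = (y, t) :: ps, x = t :: blocks ps ++ y, (size ps).+1 = wt t,
      all block_ok ps & returns 0 y].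

Lemma node_exists x : returns 0 x -> x <> [::] -> exists l, node x l.
Proof.
case: x => //= t x /andP [Ht Hx] _; rewrite add0n in Ht.
have [|ps [y [Sp Hp Ex Hy]]] := @returns_split (wt t).-1 0 x; first by rewrite addn0.
by exists ((y, t) :: ps), t, ps, y; split; rewrite ?Ex ?Sp // prednK.
Qed.

(** Cutting an excursion out of a returning path leaves a returning path, so a child embeds in its
    parent. *)
Lemma node_child x l p s : returns 0 x -> node x l -> p \in l -> returns_le s p.1 ->
  returns_le s x /\ size p.1 < size x.
Proof.
move=> Hx [t [ps [y [El Ex Sp Hp Hy]]]] Hpl Hs.
suff [u [v [Eu Hv]]] : exists u v, x = u ++ p.1 ++ v /\ returns 0 p.1 /\ 0 < size (u ++ v).
  case: Hv => Hv Huv; split; last first.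
    by rewrite Eu !size_cat addnCA -[ltnLHS]addn0 ltn_add2l -size_cat.
  case: Hs => r Hr Hi; exists (u ++ r ++ v).
    rewrite -[0]add0n; apply: (@returns_interleave _ _ (u ++ v) r) => //.
      have := interleave_cat (interleave0s r) (interleaves0 v).
      by rewrite cats0; apply: interleave_catl.
    by move: Hx; rewrite Eu; apply: returns_remove.
  by have := interleave_catr u (interleave_cat Hi (interleave0s v)); rewrite cats0 -Eu.
move: Hpl; rewrite El inE => /orP [/eqP ->|].
  exists (t :: blocks ps), [::]; rewrite Ex /= !cats0; split => //.
move=> Hpl; move: Hp Ex; case/splitPr: Hpl => ps1 ps2.
rewrite all_cat /= => /and3P [_ /andP [Hv _] _] Ex.
exists (t :: blocks ps1), (p.2 :: blocks ps2 ++ y); split => //.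
by rewrite Ex /blocks map_cat flatten_cat /= -!catA cat_rcons.
Qed.

Lemma node_le x x' l l' : node x l -> node x' l' ->
  forall2 (fun p q => returns_le p.1 q.1 /\ p.2 = q.2) l l' -> returns_le x x'.
Proof.
move=> [t [ps [y [-> -> _ _ _]]]] [t' [ps' [y' [-> -> _ _ _]]]] /= [[[r Hr Hy] <-] Hps].
suff [s Hs Hp] : returns_le (blocks ps) (blocks ps').
  exists (s ++ r); first by rewrite -[0]addn0 returns_cat.
  by apply: InterleaveL; apply: interleave_cat.
elim: ps ps' Hps => [|[v c] ps IH] [|[v' c'] ps'] //=.
  by move=> _; exists [::] => //; apply: InterleaveNil.
move=> [[[s Hs Hv] <-] /IH [s' Hs' Hi]]; exists (s ++ s').
  by rewrite -[0]addn0 returns_cat.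
rewrite /blocks /= !cat_rcons; apply: interleave_cat => //.
exact: InterleaveL.
Qed.

Lemma returns_good_pairs : good_pairs (fun x => returns 0 x) returns_le.
Proof.
move=> f0 Hf0; apply: NNPP => Hbad.
have [|f [[Sf Bf] Mf]] := @minimal_bad_sequence _ (fun x => returns 0 x) returns_le size f0.
  by split=> // i j ij Hij; apply: Hbad; exists i, j.
have [L HL] : exists L, forall n, node (f n) (L n).
  apply: (functional_choice (fun n => node (f n))) => n.
  apply: node_exists (Sf n) _ => En; apply: (Bf n n.+1) => //.
  by rewrite En; exists (f n.+1) => //; apply: interleave0s.
pose kid v := exists n p, p \in L n /\ v = p.1.
have Hkid : good_pairs kid returns_le.
  move=> k Hk.
  have [nu Hnu] : exists nu, forall j, exists p, p \in L (nu j) /\ k j = p.1.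
    exact: (functional_choice (fun j n => exists p, p \in L n /\ k j = p.1)).
  have [n0 [[j0 Ej0] Hmin]] := @least_nat (fun n => exists j, nu j = n) (nu 0)
    (ex_intro _ 0 erefl).
  have Rkid s j : returns_le s (k j) -> returns_le s (f (nu j)) /\ size (k j) < size (f (nu j)).
    by have [p [Hp ->]] := Hnu j; apply: node_child (HL _) Hp.
  have Sk j : returns 0 (k j).
    have [p [Hp ->]] := Hnu j; have [t [ps [y [El _ _ Hps Hy]]]] := HL (nu j).
    move: Hp; rewrite El inE => /orP [/eqP -> //|Hp].
    by have := allP Hps _ Hp => /andP [].
  (* Nash-Williams splice: [n0] is the least index of a parent and [k j0] a child of [f n0], so [g]
     agrees with [f] before [n0] and is strictly smaller there; by minimality it is not bad. *)
  pose g i := if i < n0 then f i else k (j0 + (i - n0)).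
  have [i [j [ij Hij]]] : exists i j, i < j /\ returns_le (g i) (g j).
    apply: NNPP => Hg; have := Mf n0 g.
    rewrite leqNgt => /(_ _ _)/negP; case.
    - by split=> [n|i j ij Hij]; [rewrite /g; case: ifP | apply: Hg; exists i, j].
    - by move=> i Hi; rewrite /g Hi.
    rewrite /g ltnn subnn addn0 -Ej0; apply: (proj2 (Rkid (k j0) j0 _)).
    by exists [::] => //; apply: interleaves0.
  (* In the mixed case a term of [f] before [n0] lies below a child, hence below its parent, whose
     index is at least [n0]. *)
  move: Hij; rewrite /g; case: ltnP => Hi; case: ltnP => Hj Hij.
  - by case: (Bf _ _ ij Hij).
  - case: (Bf i (nu (j0 + (j - n0)))); last exact: (proj1 (Rkid _ _ Hij)).
    by apply: leq_trans Hi (Hmin _ _); eexists.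
  - by lia.
  - by exists (j0 + (i - n0)), (j0 + (j - n0)); split => //; lia.
have Hseq n := @increasing_subsequences_seq _ _ _ n (increasing_subsequences_pair
  (good_pairs_subsequences returns_le_trans Hkid) (@increasing_subsequences_fin T)).
have [tt Htt] : exists tt, forall n, exists y ps, L n = (y, tt n) :: ps.
  apply: (functional_choice (fun n t => exists y ps, L n = (y, t) :: ps)) => n.
  by have [t [ps [y [-> _ _ _ _]]]] := HL n; exists t, y, ps.
(* With a constant root letter all lists of children have the same length. *)
have [g [g1 g2]] := @increasing_subsequences_fin T tt (fun _ => I).
have Et n : tt (g n.+1) = tt (g 0) by rewrite (g2 0 n.+1).
have [|i [j [ij Hij]]] := increasing_subsequences_weaken (Hseq (wt (tt (g 0))))
    (f := fun n => L (g n.+1)).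
  move=> n; split.
    have [t [ps [y [El _ Sp _ _]]]] := HL (g n.+1).
    have [y' [ps' El']] := Htt (g n.+1); rewrite -(Et n) El /= Sp.
    by move: El'; rewrite El => -[_ ->].
  suff: forall s, {subset s <= L (g n.+1)} -> forall1 (fun p => kid p.1 /\ True) s.
    by apply.
  elim=> //= p s IH Hs; split; last by apply: IH => q Hq; apply: Hs; rewrite inE Hq orbT.
  by split=> //; exists (g n.+1), p; split => //; apply: Hs; rewrite inE eqxx.
apply: (Bf (g i.+1) (g j.+1)); first exact: g1.
exact: node_le (HL _) (HL _) Hij.
Qed.

End Lukasiewicz.

Lemma returns_subsequences (G T : finType) (wt : G -> T -> nat) :
  increasing_subsequences (fun p : G * seq T => returns (wt p.1) 0 p.2)
    (fun p q => p.1 = q.1 /\ returns_le (wt p.1) p.2 q.2).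
Proof.
move=> f Sf; have [g [g1 g2]] := @increasing_subsequences_fin G (fun n => (f n).1) (fun _ => I).
have E n : (f (g n.+1)).1 = (f (g 0)).1 by rewrite (g2 0 n.+1).
have [|h [h1 h2]] := good_pairs_subsequences (@returns_le_trans T (wt (f (g 0)).1))
  (@returns_good_pairs T (wt (f (g 0)).1)) (f := fun n => (f (g n.+1)).2).
  by move=> n; rewrite -(E n).
exists (fun n => g (h n).+1); split=> [i j ij|i j ij]; first exact/g1/h1.
by rewrite !E; split => //; apply: h2.
Qed.

(** * Shuffles of copies of good words *)

Fixpoint block_word (qs : seq nat) : word :=
  match qs with
  | [::] => [::]
  | [:: q] => nseq q a
  | q :: qs' => nseq q a ++ b :: block_word qs'
  end.

Lemma na_block_word qs : na (block_word qs) = sumn qs.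
Proof.
elim: qs => //= q [|q' qs] IH; first by rewrite !lettersE /=; lia.
by rewrite !lettersE IH.
Qed.

Lemma nb_block_word qs : nb (block_word qs) = (size qs).-1.
Proof.
elim: qs => //= q [|q' qs] IH; first by rewrite !lettersE.
by rewrite !lettersE IH.
Qed.

Lemma block_word_profile qs p r : block_word qs = p ++ b :: r ->
  na p = sumn (take (nb p).+1 qs).
Proof.
have Hn q u v w' : nseq q a ++ w' = u ++ b :: v -> exists2 u', u = nseq q a ++ u' & w' = u' ++ b :: v.
  elim: q u => [|q IH] [|c u] //=; [by exists [::] | by exists (c :: u) |].
  by case=> <- /IH [u' -> ->]; exists u'.
elim: qs p => [|q [|q' qs] IH] p; first by case: p.
  by rewrite -[block_word _]cats0 => /Hn [u _]; case: u.
move=> /Hn [[|c u] -> /=]; first by rewrite !lettersE.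
by case=> <- /IH; rewrite !lettersE /= => ->.
Qed.

(** Used to recognise a colour class as [block_word qs]. If the first letters differ, the word
    starting with b forces F 0 = 0, while in the other one an a precedes the first b. *)
Lemma profile_inj (F : nat -> nat) z z' : na z = na z' -> nb z = nb z' ->
  (forall p q, z = p ++ b :: q -> na p = F (nb p)) ->
  (forall p q, z' = p ++ b :: q -> na p = F (nb p)) -> z = z'.
Proof.
elim: z z' F => [|c z IH] z' F.
  by move=> Ha Hb _ _; apply/esym/size0nil; rewrite size_na_nb -Ha -Hb.
have Hlast c' u G : (forall p q, c' :: u = p ++ b :: q -> na p = G (nb p)) ->
    forall p q, u = p ++ b :: q -> (c' == a) + na p = G ((c' == b) + nb p).
  by move=> H p q Eu; rewrite -na_cons -nb_cons; apply: (H (c' :: p) q); rewrite Eu.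
have Hsplit u : 0 < nb u -> exists p q, u = p ++ b :: q /\ nb p = 0.
  elim: u => // -[] u IHu; rewrite !lettersE => Hu.
    have [p [q [-> Hp]]] := IHu Hu; exists (a :: p), q; split => //.
  by exists [::], u.
case: z' => [|c' z'] Ha Hb Hz Hz'.
  by move: Ha Hb; case: c {Hz}; rewrite !lettersE //; lia.
suff Ec : c = c'.
  rewrite Ec in Ha Hb Hz *; congr (_ :: _).
  have Hz1 := Hlast _ _ _ Hz; have Hz1' := Hlast _ _ _ Hz'.
  apply: (IH _ (fun n => F ((c' == b) + n) - (c' == a))).
  - by move: Ha; rewrite !na_cons; lia.
  - by move: Hb; rewrite !nb_cons; lia.
  - by move=> p q /Hz1 <-; rewrite addKn.
  - by move=> p q /Hz1' <-; rewrite addKn.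
case: c c' Ha Hb Hz Hz' => [] [] // Ha Hb Hz Hz'.
  have F0 : 0 = F 0 by apply: (Hz' [::] z').
  have [p [q [Ep Hp]]] : exists p q, a :: z = p ++ b :: q /\ nb p = 0.
    by apply: Hsplit; rewrite Hb !lettersE.
  by have := Hz _ _ Ep; rewrite Hp -F0; case: p Ep {Hp} => // c p [<- _]; rewrite !lettersE.
have F0 : 0 = F 0 by apply: (Hz [::] z).
have [p [q [Ep Hp]]] : exists p q, a :: z' = p ++ b :: q /\ nb p = 0.
  by apply: Hsplit; rewrite -Hb !lettersE.
by have := Hz' _ _ Ep; rewrite Hp -F0; case: p Ep {Hp} => // c p [<- _]; rewrite !lettersE.
Qed.

(** * Distributing letters to copies *)

Section Colouring.
Variables (A B : nat -> nat).

(** A colour is a copy: [A] and [B] give the copy receiving the letter a, resp. b, of a given rank,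
    and [x], [y] count the letters b, a already read. *)
Fixpoint paint x y (w : word) : seq (letter * nat) :=
  match w with
  | [::] => [::]
  | a :: w' => (a, A y) :: paint x y.+1 w'
  | b :: w' => (b, B x) :: paint x.+1 y w'
  end.

Definition coloured c (P : seq (letter * nat)) : word := [seq p.1 | p <- P & p.2 == c].

Lemma unzip1_paint x y w : unzip1 (paint x y w) = w.
Proof. by elim: w x y => //= -[] w IH x y /=; rewrite IH. Qed.

Lemma paint_split x y w P l c Q : paint x y w = P ++ (l, c) :: Q ->
  exists p q, [/\ w = p ++ l :: q, P = paint x y p &
    c = if l is a then A (y + na p) else B (x + nb p)].
Proof.
elim: w x y P => [|d w IH] x y [|e P] //=.
- case: d => [] [<- <- _]; exists [::], w; rewrite !lettersE //.
- case: d => [] [<- /IH [p [q [-> -> ->]]]].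
    by exists (a :: p), q; split => //; case: (l); rewrite !lettersE //= addSnnS.
  by exists (b :: p), q; split => //; case: (l); rewrite !lettersE //= addSnnS.
Qed.

Lemma na_coloured c x y w :
  na (coloured c (paint x y w)) = count (fun i => A i == c) (iota y (na w)).
Proof.
elim: w x y => //= -[] w IH x y; rewrite !lettersE /coloured /=; case: eqP => //= _;
  by rewrite ?lettersE IH.
Qed.

Lemma nb_coloured c x y w :
  nb (coloured c (paint x y w)) = count (fun i => B i == c) (iota x (nb w)).
Proof.
elim: w x y => //= -[] w IH x y; rewrite !lettersE /coloured /=; case: eqP => //= _;
  by rewrite ?lettersE IH.
Qed.

Lemma coloured_split c P p q l : coloured c P = p ++ l :: q ->
  exists P' Q', P = P' ++ (l, c) :: Q' /\ p = coloured c P'.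
Proof.
elim: P p => [|[d e] P IH] p; first by case: p.
rewrite /coloured /=; case: eqP => [->|ne] /=.
  case: p => [|f p] [<- E]; first by exists [::], P.
  have [P' [Q' [-> ->]]] := IH _ E.
  by exists ((d, c) :: P'), Q'; rewrite /coloured /= eqxx.
move=> /IH [P' [Q' [-> ->]]]; exists ((d, e) :: P'), Q'; split => //.
by rewrite /coloured /=; case: eqP.
Qed.

End Colouring.

Lemma copies_of_colouring w N (P : seq (letter * nat)) : all (fun p => p.2 < N) P ->
  (forall c, c < N -> coloured c P = w) -> copies w N (unzip1 P).
Proof.
elim: N P => [|N IH] P HP Hc; first by case: P HP {Hc} => //= _; exact: Copies0.
pose P' := [seq p <- P | p.2 != N].
have HP' : copies w N (unzip1 P').
  apply: IH => [|c cN].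
    rewrite all_filter; apply: sub_all HP => p /=; rewrite ltnS leq_eqVlt => /orP [->//|->].
    by rewrite implybT.
  rewrite -(Hc c) ?ltnS 1?ltnW //; congr map; rewrite -filter_predI.
  by apply: eq_filter => p /=; case: eqP => //= ->; rewrite ltn_eqF.
apply: CopiesS HP' _; rewrite -(Hc N) //.
have := interleave_sym (interleave_map fst (interleave_filter (fun p => p.2 == N) P)).
by [].
Qed.

Section Columns.
Variables (N : nat).

Definition colour_block n q := flatten [seq nseq q c | c <- iota 0 n].
(** The copies receiving the successive letters a: for each block index in turn, copies 0 to N-1 get
    their whole block one after the other. *)
Definition colours qs := flatten [seq colour_block N q | q <- qs].

Lemma size_colour_block n q : size (colour_block n q) = q * n.
Proof.
rewrite /colour_block size_flatten /shape -map_comp.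
elim: n 0 => [|n IH] s /=; first by rewrite muln0.
by rewrite IH size_nseq mulnS.
Qed.

Lemma colour_blockD n m q : exists s, colour_block (n + m) q = colour_block n q ++ s.
Proof. by rewrite /colour_block iotaD map_cat flatten_cat; eexists. Qed.

Lemma count_colour_block c n q : count_mem c (colour_block n q) = (c < n) * q.
Proof.
elim: n => // n IH; rewrite /colour_block -addn1 iotaD map_cat flatten_cat count_cat [LHS]/=.
rewrite -/(colour_block n q) IH cats0 count_nseq /= add0n addn1 ltnS (eq_sym n c).
by case: (ltngtP c n) => //= _; lia.
Qed.

Lemma count_take_colours c qs e n : n <= N ->
  count_mem c (take (N * sumn (take e qs) + nth 0 qs e * n) (colours qs)) =
  (c < N) * sumn (take e qs) + (c < n) * nth 0 qs e.
Proof.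
move=> nN; elim: qs e => [|q qs IH] [|e] //=; rewrite ?muln0 //.
  rewrite add0n /colours /= takel_cat; last first.
    by rewrite size_colour_block leq_mul2l nN orbT.
  have [s Es] := colour_blockD n (N - n) q; rewrite subnKC // in Es.
  by rewrite Es take_size_cat ?size_colour_block // count_colour_block.
rewrite mulnDr -addnA /colours /= take_cat size_colour_block mulnC ltnNge leq_addr /=.
by rewrite addKn count_cat IH count_colour_block mulnDr addnA.
Qed.

Lemma size_colours qs : size (colours qs) = N * sumn qs.
Proof.
rewrite /colours; elim: qs => [|q qs IH] /=; first by rewrite muln0.
by rewrite size_cat IH size_colour_block mulnDr mulnC.
Qed.

Lemma nth_colours qs i : 0 < N -> nth 0 (colours qs) i < N.
Proof.
move=> N0; have [Hi|Hi] := ltnP i (size (colours qs)); last by rewrite nth_default.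
have /flatten_mapP [q _] := mem_nth 0 Hi.
by move=> /flatten_mapP [c]; rewrite mem_iota mem_nseq => /andP [_ +] /andP [_ /eqP ->].
Qed.

Lemma count_iotaS (P : pred nat) n : count P (iota 0 n.+1) = count P (iota 0 n) + P n.
Proof. by rewrite -addn1 iotaD count_cat /= addn0. Qed.

Lemma count_modn c t e : c < N -> e <= N ->
  count (fun i => i %% N == c) (iota 0 (t * N + e)) = t + (c < e).
Proof.
move=> cN; elim: t e => [|t IHt]; last first.
  move=> e eN; have {IHt} := IHt N (leqnn N); rewrite cN => Ht.
  elim: e eN => [|e IHe] eN; first by rewrite addn0 mulSn addnC Ht; lia.
  rewrite addnS count_iotaS (IHe (ltnW eN)); cbv beta; rewrite modnMDl modn_small //.
  by rewrite ltnS (eq_sym e c); case: (ltngtP c e) => //= _; lia.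
elim=> [|e IHe] eN; first by rewrite addn0.
rewrite addnS count_iotaS (IHe (ltnW eN)); cbv beta; rewrite modnMDl modn_small //.
by rewrite ltnS (eq_sym e c); case: (ltngtP c e) => //= _; lia.
Qed.

End Columns.

(* Up to exchanging the letters, the nonempty good words are the [block_word qs] where [qs] is
   a plateau with at least two entries. *)
Definition plateau (qs : seq nat) := forall t, t.+2 < size qs ->
  nth 0 qs t <= nth 0 qs t.+1 /\ nth 0 qs t.+2 <= nth 0 qs t.+1.

(** * Shuffles as paths confined to slabs *)

Definition walk (Q : nat -> nat -> Prop) x y (z : word) :=
  forall z1 z2, z = z1 ++ z2 -> Q (x + nb z1) (y + na z1).

Lemma walk_cat Q x y z1 z2 : walk Q x y (z1 ++ z2) <->
  walk Q x y z1 /\ walk Q (x + nb z1) (y + na z1) z2.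
Proof.
split=> [H|[H1 H2] u1 u2 /esym E].
  split=> u1 u2 E; first by apply: (H u1 (u2 ++ z2)); rewrite E catA.
  by rewrite -!addnA -na_cat -nb_cat; apply: (H (z1 ++ u1) u2); rewrite E catA.
have [Hu|Hu] := leqP (size u1) (size z1).
  apply: (H1 u1 (drop (size u1) z1)).
  have := congr1 (take (size u1)) E; rewrite take_size_cat // takel_cat // => Et.
  by rewrite -[LHS](cat_take_drop (size u1)) -Et.
have Eu : u1 = z1 ++ drop (size z1) u1.
  have := congr1 (take (size z1)) E; rewrite [RHS]take_size_cat // takel_cat ?(ltnW Hu) // => Et.
  by rewrite -[LHS](cat_take_drop (size z1)) Et.
rewrite Eu na_cat nb_cat !addnA; apply: (H2 _ u2).
have := congr1 (drop (size z1)) E; rewrite [RHS]drop_size_cat // => <-.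
by rewrite {1}Eu -catA drop_size_cat.
Qed.

Lemma walk_start Q x y z : walk Q x y z -> Q x y.
Proof. by move=> /(_ [::] z erefl); rewrite !lettersE. Qed.

Lemma walk_end Q x y z : walk Q x y z -> Q (x + nb z) (y + na z).
Proof. by move=> /(_ z [::]); rewrite cats0; apply. Qed.

Section Slabs.
Variable qs : seq nat.
Let q t := nth 0 qs t.
Let sm t := sumn (take t qs).

(* With [x] letters b and [y] letters a read from a shuffle of [N] copies of [block_word qs],
   these say that, for [t * N <= x <= t.+1 * N], all blocks of index at most [t - 1], and the
   first [x - t * N] blocks of index [t], are completely read (floor), while at most the first
   [x - t * N] blocks of index [t.+1] have been started (ceiling). *)
Definition floor_ok N t x y := N * sm t + q t * x <= y + q t * (t * N).
Definition ceil_ok N t x y := y + q t.+1 * (t * N) <= N * sm t.+1 + q t.+1 * x.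
Definition slab_ok N t x y := floor_ok N t x y /\ ceil_ok N t x y.

Lemma partial_sumS t : sm t.+1 = sm t + q t.
Proof.
rewrite /sm /q; elim: qs t => [|x s IH] [|t] //=; first by rewrite take0 addn0.
by rewrite IH addnA.
Qed.

Lemma partial_sum_le X d M : (forall i, i < d -> q (X + i) <= M) ->
  sm (X + d) <= sm X + M * d.
Proof.
elim: d => [|d IH] H; first by rewrite addn0 leq_addr.
rewrite addnS partial_sumS mulnS; have := H d (leqnn _).
have := IH (fun i Hi => H i (ltnW Hi)); lia.
Qed.

Lemma partial_sum_ge X d M : (forall i, i < d -> M <= q (X + i)) ->
  sm X + M * d <= sm (X + d).
Proof.
elim: d => [|d IH] H; first by rewrite addn0 muln0 addn0.
rewrite addnS partial_sumS mulnS; have := H d (leqnn _).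
have := IH (fun i Hi => H i (ltnW Hi)); lia.
Qed.

Lemma block_word_prefix p r : block_word qs = p ++ r -> qs <> [::] ->
  [/\ nb p < size qs, sm (nb p) <= na p & na p <= sm (nb p).+1].
Proof.
move=> E qs0; split.
- have := congr1 nb E; rewrite nb_cat nb_block_word; case: (qs) qs0 => //= *; lia.
- elim/last_ind: p r E => [|p c IH] r E; first by rewrite /sm take0.
  rewrite cat_rcons in E; have := IH _ E.
  rewrite -cats1 !lettersE; case: c E => E; rewrite !lettersE; first by lia.
  by rewrite addn1 /sm (block_word_profile E).
- elim: r p E => [|c r IH] p E.
    have := congr1 na E; have := congr1 nb E; rewrite cats0 na_block_word nb_block_word => <- <-.
    by rewrite /sm prednK ?take_size //; case: (qs) qs0.
  case: c E => E; last by rewrite /sm -(block_word_profile E).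
  by rewrite -cat_rcons in E; have := IH _ E; rewrite -cats1 !lettersE addn1; lia.
Qed.

Hypothesis Hqs : plateau qs.
Variable k : nat.
Hypothesis size_qs : size qs = k.+2.

(** Together with [plateau_right], this makes the entries of index 1 to [k] equal; only the first
    and the last may differ. *)
Lemma plateau_left i j : i <= j -> j <= k -> q i <= q j.
Proof.
move=> ij jk; elim: j ij jk => [|j IH]; first by rewrite leqn0 => /eqP ->.
rewrite leq_eqVlt => /orP [/eqP -> //|ij] jk.
apply: leq_trans (IH ij (ltnW jk)) _; apply: (proj1 (Hqs _)); rewrite size_qs; lia.
Qed.

Lemma plateau_right i j : 0 < i -> i <= j -> j <= k.+1 -> q j <= q i.
Proof.
move=> i0 ij jk; elim: j ij jk => [|j IH]; first by lia.
rewrite leq_eqVlt => /orP [/eqP -> //|ij] jk.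
apply: leq_trans (IH ij (ltnW jk)).
by case: j {IH} ij jk => [|j] ij jk; [lia | apply: (proj2 (Hqs _)); rewrite size_qs; lia].
Qed.

(** The entries up to index [k] are nondecreasing, so the partial sums are convex there and lie
    above their supporting line of slope [q t]. Dually, [ceil_line] is concavity from index 1 on. *)
Lemma floor_line t x : t <= k -> x <= k.+1 -> sm t + q t * x <= sm x + q t * t.
Proof.
move=> tk xk; have [tx|xt] := leqP t x.
  have -> : x = t + (x - t) by lia.
  have : sm t + q t * (x - t) <= sm (t + (x - t)).
    by apply: partial_sum_ge => i Hi; apply: plateau_left; lia.
  by rewrite mulnDr; lia.
have : sm (x + (t - x)) <= sm x + q t * (t - x).
  by apply: partial_sum_le => i Hi; apply: plateau_left; lia.
rewrite subnKC ?(ltnW xt) // mulnBr.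
have : q t * x <= q t * t by rewrite leq_mul2l ltnW ?orbT.
lia.
Qed.

Lemma ceil_line t x : t <= k -> x <= k.+1 ->
  sm x.+1 + q t.+1 * t <= sm t.+1 + q t.+1 * x.
Proof.
move=> tk xk; have [tx|xt] := leqP t x.
  have -> : x.+1 = t.+1 + (x - t) by lia.
  have : sm (t.+1 + (x - t)) <= sm t.+1 + q t.+1 * (x - t).
    apply: partial_sum_le => i Hi; have [Hk|Hk] := leqP (t.+1 + i) k.+1.
      by apply: plateau_right; lia.
    by rewrite /q nth_default // size_qs.
  rewrite mulnBr; have : q t.+1 * t <= q t.+1 * x by rewrite leq_mul2l tx orbT.
  by lia.
have : sm x.+1 + q t.+1 * (t - x) <= sm (x.+1 + (t - x)).
  by apply: partial_sum_ge => i Hi; apply: plateau_right; lia.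
rewrite (_ : x.+1 + (t - x) = t.+1) ?mulnBr; last by lia.
have : q t.+1 * x <= q t.+1 * t by rewrite leq_mul2l ltnW ?orbT.
lia.
Qed.

(* The conditions are linear, hence add up over the copies, and hold for one copy because the
   partial sums of a plateau lie above (resp. below) the lines through consecutive values. *)
Lemma copies_slab_ok N v1 v2 t : copies (block_word qs) N (v1 ++ v2) -> t <= k ->
  slab_ok N t (nb v1) (na v1).
Proof.
move=> H tk; move: H; apply: (@copies_prefix _ (fun N v => slab_ok N t (nb v) (na v))).
  by rewrite /slab_ok /floor_ok /ceil_ok !lettersE ?muln0; split.
move=> n u p r v [Hf Hc] Ew Hv; rewrite (interleave_na Hv) (interleave_nb Hv).
have [|Hp Hp1 Hp2] := block_word_prefix Ew; first by case: (qs) size_qs.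
have Hl := @floor_line t (nb p) tk; have Hu := @ceil_line t (nb p) tk.
rewrite size_qs ltnS in Hp; have {}Hl := Hl Hp; have {}Hu := Hu Hp.
move: Hf Hc; rewrite /slab_ok /floor_ok /ceil_ok !mulSn !mulnDr; lia.
Qed.

(** Letters a standing at a boundary abscissa (t+1)N may belong to either slab: there the conditions
    of slabs [t] and [t.+1] coincide. *)
Fixpoint slabs_ok N t y (vs : seq word) : Prop :=
  if vs is v :: vs' then
    [/\ nb v = N, walk (slab_ok N t) (t * N) y v & slabs_ok N t.+1 (y + na v) vs']
  else True.

Lemma cut_nb (v : word) M : M <= nb v -> exists v1 v2, v = v1 ++ v2 /\ nb v1 = M.
Proof.
elim: v M => [|c v IH] M; rewrite !lettersE; first by exists [::], [::]; split => //; rewrite ?nb_nil; lia.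
move=> HM; case: M HM => [|M] HM; first by exists [::], (c :: v).
have [|v1 [v2 [-> H]]] := IH (M.+1 - (c == b)); first by case: (c == b) HM; lia.
exists (c :: v1), v2; rewrite lettersE H; split => //.
by clear H; case: c HM; rewrite !lettersE; lia.
Qed.

Lemma cut_slabs n N (v : word) : nb v = n.+1 * N ->
  exists vs, [/\ v = flatten vs, size vs = n.+1 & all (fun u => nb u == N) vs].
Proof.
elim: n v => [|n IH] v Hv; first by exists [:: v]; rewrite /= cats0 Hv mul1n eqxx.
have [|v1 [v2 [E H1]]] := @cut_nb v N; first by rewrite Hv mulSn leq_addr.
have [|vs [E2 S2 H2]] := IH v2; first by move: Hv; rewrite E nb_cat; lia.
by exists (v1 :: vs); rewrite E E2 /= H1 S2 eqxx.
Qed.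

Lemma copies_slabs N v : copies (block_word qs) N v ->
  exists vs, [/\ v = flatten vs, size vs = k.+1 & slabs_ok N 0 0 vs].
Proof.
move=> H; have := copies_nb H; rewrite nb_block_word size_qs mulnC => /cut_slabs [vs [E Hs Hall]].
suff Hgen us t u : all (fun u => nb u == N) us -> nb u = t * N -> t + size us <= k.+1 ->
    copies (block_word qs) N (u ++ flatten us) -> slabs_ok N t (na u) us.
  by exists vs; split => //; apply: (Hgen vs 0 [::]); rewrite ?Hs -?E.
elim: us t u => //= v' us IH t u /andP [/eqP Hv' Hus] Hu Ht Hc; split => //.
  move=> u1 u2 Eu; rewrite -Hu -na_cat -nb_cat.
  apply: (@copies_slab_ok _ _ (u2 ++ flatten us)); last by lia.
  by rewrite -catA (catA u1) -Eu.
rewrite -na_cat; apply: IH => //; last by rewrite -catA.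
- by rewrite nb_cat Hu Hv' mulSn addnC.
- by rewrite addSnnS.
Qed.

(** Where the b of rank t'N + c is read, block t' of copy [c] has to be complete and its block t'+1
    not yet started. The first is the floor just after this b, the second the ceiling just before
    it. *)
Lemma slabs_point N t y vs p r : slabs_ok N t y vs -> flatten vs = p ++ b :: r ->
  exists t' c, [/\ t' < t + size vs, c < N, t * N + nb p = t' * N + c,
    floor_ok N t' (t * N + nb p).+1 (y + na p) & ceil_ok N t' (t * N + nb p) (y + na p)].
Proof.
elim: vs t y p => [|v vs IH] t y p /=; first by case: p.
move=> [Hv Hw Hvs] E; have [Hp|Hp] := ltnP (size p) (size v).
  have [r' Er] : exists r', v = p ++ b :: r'.
    exists (drop (size p).+1 v).
    have := congr1 (take (size p).+1) E; rewrite takel_cat // -cat_rcons.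
    rewrite take_size_cat ?size_rcons // => Et.
    by rewrite -cat_rcons -Et cat_take_drop.
  exists t, (nb p); split; first by rewrite -addSnnS; lia.
  - by have := Hv; rewrite Er !lettersE; lia.
  - by [].
  - have Er' : v = rcons p b ++ r' by rewrite cat_rcons.
    have [+ _] := Hw _ _ Er'.
    by rewrite -cats1 !lettersE addn1 addnS.
  - by have [_] := Hw p (b :: r') Er.
have Ep : p = v ++ drop (size v) p.
  have := congr1 (take (size v)) E; rewrite take_size_cat // takel_cat // => Et.
  by rewrite {1}Et cat_take_drop.
have [|t' [c [H1 H2 H3 H4 H5]]] := IH _ _ (drop (size v) p) Hvs.
  by have := congr1 (drop (size v)) E; rewrite drop_size_cat // => ->; rewrite {1}Ep -catA drop_size_cat.
have En : t.+1 * N + nb (drop (size v) p) = t * N + nb p.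
  by rewrite {2}Ep nb_cat Hv mulSn; lia.
have Ea : y + na v + na (drop (size v) p) = y + na p by rewrite {2}Ep na_cat addnA.
rewrite En Ea in H3 H4 H5; exists t', c; split => //; lia.
Qed.

(* First-in first-out distribution: the letter b of rank [x] goes to copy [x %% N], and the blocks
   of index [t] are filled copy after copy before those of index [t.+1]. *)
Lemma slabs_copies N vs : slabs_ok N 0 0 vs -> size vs = k.+1 ->
  na (flatten vs) = N * sumn qs -> copies (block_word qs) N (flatten vs).
Proof.
move=> Hvs Hs Ha; set w := flatten vs.
have Hb : nb w = N * k.+1.
  have Hgen us : forall t y, slabs_ok N t y us -> nb (flatten us) = N * size us.
    elim: us => [|v us IH] t y /=; first by rewrite muln0.
    by move=> [Hv _ /IH]; rewrite nb_cat Hv mulnS => ->.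
  by rewrite /w -Hs; apply: Hgen Hvs.
have [N0|N0] := posnP N.
  rewrite N0 (size0nil (s := w)); first exact: Copies0.
  by rewrite size_na_nb Ha Hb N0.
pose A i := nth 0 (colours N qs) i; pose B i := i %% N.
pose P := paint A B 0 0 w.
have HA c n : n <= na w -> count (fun i => A i == c) (iota 0 n) =
    count_mem c (take n (colours N qs)).
  move=> Hn; rewrite -(map_nth_iota0 0); last by rewrite size_colours -Ha.
  by rewrite count_map; apply: eq_count.
rewrite -(unzip1_paint A B 0 0 w); apply: copies_of_colouring => [|c cN].
  apply/allP => -[l d] /(nthP (a, 0)) [i Hi Ei].
  have EP : P = take i P ++ (l, d) :: drop i.+1 P by rewrite -{1}(cat_take_drop i P) -Ei -drop_nth.
  have [p [r [_ _ ->]]] := paint_split EP.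
  by case: (l); [apply: nth_colours | apply: ltn_pmod].
apply: (@profile_inj (fun n => sm n.+1)).
- rewrite na_coloured HA // na_block_word Ha.
  have := count_take_colours c qs (size qs) (leq0n N).
  by rewrite take_size nth_default // cN !(mul0n, muln0, addn0, mul1n).
- rewrite nb_coloured nb_block_word size_qs /= Hb mulnC -[_ * N]addn0 count_modn //.
  by rewrite ltn0 addn0.
- move=> p r /coloured_split [P' [Q' [EP ->]]].
  have [p0 [r0 [Ew -> Ec]]] := paint_split EP.
  rewrite na_coloured nb_coloured.
  have [t [c' [Ht Hc' Ex Hf Hce]]] := slabs_point Hvs Ew.
  rewrite ?(add0n, mul0n) in Ht Ec Ex Hf Hce.
  have Ecc : c = c' by rewrite Ec /B Ex modnMDl modn_small.
  rewrite Ex count_modn ?(ltnW Hc') // Ecc ltnn addn0.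
  have Hp0 : na p0 <= na w by rewrite Ew na_cat leq_addr.
  rewrite HA //.
  have mono m n : m <= n -> count_mem c' (take m (colours N qs)) <=
      count_mem c' (take n (colours N qs)).
    by move=> mn; rewrite -(subnKC mn) takeD count_cat leq_addr.
  apply/eqP; rewrite eqn_leq; apply/andP; split.
    (* The ceiling bounds the letters a of copy [c'] from above by the cut before its block [t.+1];
       the floor then bounds them from below by the cut after its block [t]. *)
    have := @mono (na p0) (N * sm t.+1 + q t.+1 * c') _.
    rewrite count_take_colours ?(ltnW Hc') // Hc' ltnn mul1n mul0n addn0; apply.
    by move: Hce; rewrite /ceil_ok Ex mulnDr; lia.
  have := @mono (N * sm t + q t * c'.+1) (na p0) _.
  rewrite count_take_colours // Hc' ltnSn !mul1n -/(sm t) -/(q t) -partial_sumS; apply.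
  by move: Hf; rewrite /floor_ok Ex -addnS mulnDr; lia.
- exact: block_word_profile.
Qed.

End Slabs.

(** * Good words *)

(* In a code word, [inr true] and [inr false] climb from height 0 to the initial height of the
   coded factor, and come back from its final height; [inl] letters are those of the factor. *)
Definition code_weight (s : nat) (c : letter + bool) : nat :=
  match c with
  | inl a => 0
  | inl b => s.+1
  | inr true => 2
  | inr false => 0
  end.

Definition code s h (z : word) : seq (letter + bool) :=
  nseq h (inr true) ++ map inl z ++ nseq (h + s * nb z - na z) (inr false).

Definition letters_of (x : seq (letter + bool)) : word :=
  pmap (fun c => if c is inl l then Some l else None) x.

Definition climbs (x : seq (letter + bool)) := count_mem (inr true) x.

Lemma letters_of_code s h z : letters_of (code s h z) = z.
Proof.
have Hinr n c : letters_of (nseq n (inr c)) = [::] by elim: n.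
by rewrite /code /letters_of !pmap_cat -!/(letters_of _) !Hinr cats0 /letters_of map_pK.
Qed.

Lemma climbs_code s h z : climbs (code s h z) = h.
Proof.
rewrite /climbs /code !count_cat !count_nseq /= count_map mul1n mul0n addn0.
by rewrite (eq_count (a2 := pred0)) ?count_pred0 ?addn0.
Qed.

Lemma returns_code s h z : (forall z1 z2, z = z1 ++ z2 -> na z1 <= h + s * nb z1) ->
  returns (code_weight s) 0 (code s h z).
Proof.
move=> Hz; have Hup m x n : returns (code_weight s) n (nseq m (inr true) ++ x) =
    returns (code_weight s) (n + m) x.
  elim: m n => [|m IH] n /=; first by rewrite addn0.
  by rewrite addn2 /= IH addSnnS.
rewrite /code Hup add0n; elim: z h Hz => [|c z IH] h Hz.
  by rewrite !lettersE subn0 /=; elim: h {Hz} => //= h IHh; rewrite addn0 IHh.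
have Hc := Hz [:: c] z erefl; have {IH} IH h' Hh' := IH h' Hh'.
case: c Hz Hc => Hz Hc /=; rewrite !lettersE in Hc *; rewrite ?lettersE.
  rewrite Hc (_ : h + s * nb z - (1 + na z) = h.-1 + s * nb z - na z); last by lia.
  apply: IH => z1 z2 Ez; have := Hz (a :: z1) z2; rewrite Ez !lettersE => /(_ erefl); lia.
rewrite addnS /= (_ : h + s * (1 + nb z) - na z = h + s + s * nb z - na z); last by lia.
by apply: IH => z1 z2 Ez; have := Hz (b :: z1) z2; rewrite Ez !lettersE => /(_ erefl); lia.
Qed.

Lemma returns_prefix s h r1 r2 : returns (code_weight s) h (r1 ++ r2) ->
  na (letters_of r1) <= h + s * nb (letters_of r1) + climbs r1.
Proof.
elim: r1 h => [|c r1 IH] h //= /andP [Hc /IH]; rewrite /climbs /=.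
by case: c Hc => [[]|[]] /=; rewrite ?lettersE; lia.
Qed.

Lemma letters_of_split r x y : letters_of r = x ++ y ->
  exists r1 r2, r = r1 ++ r2 /\ letters_of r1 = x.
Proof.
elim: r x => [|c r IH] [|l x] //=; try by exists [::]; eexists.
case: c => [c|c] /= E.
  by case: E => -> E; have [r1 [r2 [-> <-]]] := IH _ E; exists (inl l :: r1), r2.
by have [r1 [r2 [-> Ex]]] := IH (l :: x) E; exists (inr c :: r1), r2.
Qed.

(** The remainder contains exactly [h' - h] climbing letters, wherever they stand; dropping its
    [inr] letters thus lets its path fall at most that far below 0. *)
Lemma code_le s h z h' z' : returns_le (code_weight s) (code s h z) (code s h' z') ->
  h <= h' /\ exists2 r, interleave z r z' &
    forall r1 r2, r = r1 ++ r2 -> na r1 + h <= h' + s * nb r1.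
Proof.
move=> [r Hr Hi]; have := interleave_count (pred1 (inr true)) Hi.
rewrite -!/(climbs _) !climbs_code => Eh; split; first by lia.
exists (letters_of r).
  rewrite -(letters_of_code s h z) -(letters_of_code s h' z'); exact: interleave_pmap.
move=> r1 r2 /letters_of_split [x1 [x2 [Ex <-]]].
have := Hr; rewrite Ex => /returns_prefix.
have : climbs r = climbs x1 + climbs x2 by rewrite Ex /climbs count_cat.
lia.
Qed.

(** Always [C] pieces, the last ones possibly empty, so that the codes form sequences of fixed
    length. *)
Fixpoint chop C s (v : word) : seq word :=
  if C is C'.+1 then take s v :: chop C' s (drop s v) else [::].

Lemma size_chop C s v : size (chop C s v) = C.
Proof. by elim: C v => //= C IH v; rewrite IH. Qed.

Lemma flatten_chop C s v : size v <= C * s -> flatten (chop C s v) = v.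
Proof.
elim: C v => [|C IH] v /=; first by rewrite leqn0 => /eqP/size0nil ->.
by rewrite mulSn => H; rewrite IH ?cat_take_drop // size_drop; lia.
Qed.

Lemma all_chop C s v : all (fun z => size z <= s) (chop C s v).
Proof.
elim: C v => //= C IH v; rewrite IH andbT size_take; case: ltnP => //.
Qed.

Section PlateauWords.
Variables (qs : seq nat) (k : nat).
Hypothesis Hqs : plateau qs.
Hypothesis size_qs : size qs = k.+2.
Let q t := nth 0 qs t.
Let sm t := sumn (take t qs).
Variable G : nat.
Hypothesis G_gt0 : 0 < G.
Hypothesis q_le_G : forall t, q t <= G.
(** A letter changes the distance to either line by at most [G], so a chunk of length [chunk_size N]
    changes it by at most N/4 + G, while the number [C] of chunks per slab does not depend on
    [N]. *)
Let C := 4 * G * size (block_word qs).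
Let chunk_size N := N %/ (4 * G) + 1.

Definition slope (g : 'I_k.+1 * bool) := if g.2 then q g.1.+1 else q g.1.
Definition code_le_tag (x y : ('I_k.+1 * bool) * seq (letter + bool)) :=
  x.1 = y.1 /\ returns_le (code_weight (slope x.1)) x.2 y.2.

Definition floor_dist N t x y := y + q t * (t * N) - (N * sm t + q t * x).
Definition ceil_dist N t x y := N * sm t.+1 + q t.+1 * x - (y + q t.+1 * (t * N)).

(* Whether the ceiling is the constraint to be recorded: then the floor is either vacuous or
   far away. *)
Definition near_ceil N t x y :=
  if q t == 0 then true else if q t.+1 == 0 then false else N <= 2 * floor_dist N t x y.

(** A letter a lowers the distance to the ceiling but raises the distance to the floor. Read
    backwards, from the distance at the end of the chunk, the latter also loses 1 at each a and
    gains the slope at each b, as [code] requires. *)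
Definition chunk_code N t x y z : ('I_k.+1 * bool) * seq (letter + bool) :=
  ((inord t, near_ceil N t x y),
   if near_ceil N t x y then code (q t.+1) (ceil_dist N t x y) z
   else code (q t) (floor_dist N t (x + nb z) (y + na z)) (rev z)).

Definition in_slab N t x y := slab_ok qs N t x y /\ t * N <= x <= t * N + N.

Lemma floor_vacuous t : t <= k -> q t = 0 -> sm t = 0.
Proof.
move=> tk qt; have := @partial_sum_le qs 0 t 0 _; rewrite add0n take0 /= mul0n -/(sm t).
move=> H; apply/eqP; rewrite -leqn0; apply: H => i Hi; rewrite -[X in _ <= X]qt.
by apply: (plateau_left Hqs size_qs) => //; lia.
Qed.

(** The later blocks being empty, the ceiling only bounds the letters a by their total number,
    whence the bound on [yr + na r] in the comparison lemmas. *)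
Lemma ceil_vacuous t : t <= k -> q t.+1 = 0 -> sm t.+1 = sumn qs.
Proof.
move=> tk qt; have := @partial_sum_le qs t.+1 (size qs - t.+1) 0 _.
rewrite subnKC; last by rewrite size_qs; lia.
rewrite take_size mul0n addn0 -/(sm t.+1) => H; apply/eqP; rewrite eqn_leq; apply/andP; split.
  by rewrite /sm -{2}(cat_take_drop t.+1 qs) sumn_cat leq_addr.
apply: H => i Hi; rewrite -[X in _ <= X]qt.
by apply: (plateau_right Hqs size_qs) => //; rewrite size_qs in Hi; lia.
Qed.

Lemma rev_na (z : word) : na (rev z) = na z.
Proof. exact: count_rev. Qed.
Lemma rev_nb (z : word) : nb (rev z) = nb z.
Proof. exact: count_rev. Qed.

Lemma chunk_code_returns N t x y z : t <= k -> walk (slab_ok qs N t) x y z ->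
  returns (code_weight (slope (chunk_code N t x y z).1)) 0 (chunk_code N t x y z).2.
Proof.
move=> tk Hw; rewrite /chunk_code /slope /= inordK //.
case: near_ceil; apply: returns_code => z1 z2 E.
  have [_] := Hw _ _ E; have [_] := walk_start Hw.
  rewrite /ceil_ok /ceil_dist -/(q t.+1) -/(sm t.+1) => H1 H2.
  by move: H2; rewrite mulnDr; lia.
have Ez : z = rev z2 ++ rev z1 by rewrite -rev_cat -E revK.
have [+ _] := Hw _ _ Ez; have [+ _] := walk_end Hw.
rewrite /floor_ok /floor_dist -/(q t) -/(sm t) !rev_na !rev_nb.
have -> : na z = na z1 + na z2 by rewrite -rev_na E na_cat.
have -> : nb z = nb z1 + nb z2 by rewrite -rev_nb E nb_cat.
by rewrite !mulnDr; lia.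
Qed.

(** The vertical gap between the two lines goes linearly from N q_t to N q_{t+1} across the slab. *)
Lemma dist_sum N t x y : in_slab N t x y ->
  floor_dist N t x y + ceil_dist N t x y = q t * (t * N + N - x) + q t.+1 * (x - t * N).
Proof.
move=> [[Hf Hc] Hx]; have [d Ed] : exists d, x = t * N + d by exists (x - t * N); lia.
have [e Ee] : exists e, N = d + e by exists (N - d); lia.
have -> : x - t * N = d by lia. have -> : t * N + N - x = e by lia.
move: Hf Hc; rewrite /floor_ok /ceil_ok /floor_dist /ceil_dist -/(q t) -/(q t.+1) -/(sm t) -/(sm t.+1).
have -> : sm t.+1 = sm t + q t by apply: partial_sumS.
rewrite {}Ed !mulnDr; have : N * q t = q t * d + q t * e by rewrite {1}Ee; lia.
lia.
Qed.

Lemma dist_bound N t x y : in_slab N t x y ->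
  floor_dist N t x y <= G * N /\ ceil_dist N t x y <= G * N.
Proof.
move=> H; have := dist_sum H; case: H => _ Hx.
have : q t * (t * N + N - x) <= G * (t * N + N - x) by rewrite leq_mul2r q_le_G orbT.
have : q t.+1 * (x - t * N) <= G * (x - t * N) by rewrite leq_mul2r q_le_G orbT.
have : G * N = G * (t * N + N - x) + G * (x - t * N) by rewrite -mulnDr; congr (_ * _); lia.
lia.
Qed.

Lemma dist_large N t x y : in_slab N t x y -> 0 < q t -> 0 < q t.+1 ->
  N <= floor_dist N t x y + ceil_dist N t x y.
Proof.
move=> H q0 q1; rewrite (dist_sum H); case: H => _ Hx.
have : 1 * (t * N + N - x) <= q t * (t * N + N - x) by rewrite leq_mul2r q0 orbT.
have : 1 * (x - t * N) <= q t.+1 * (x - t * N) by rewrite leq_mul2r q1 orbT.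
lia.
Qed.

Lemma chunk_size_bound N n : n <= chunk_size N -> 4 * (G * n) <= N + 4 * G.
Proof.
rewrite /chunk_size => Hn; have := leq_trunc_div N (4 * G).
have : 4 * G * n <= 4 * G * (N %/ (4 * G) + 1) by rewrite leq_mul2l Hn orbT.
lia.
Qed.

(** By linearity, the distance of the remainder to a line is the difference of those of the two
    words. For the recorded line [code_le] makes it nonnegative. If the other line is not vacuous,
    the larger word starts the chunk at distance at least (N+M)/2 and loses at most (N+M)/4 + G, and
    the smaller one is at distance at most GN: 4G(N+1) <= N+M suffices. *)
Lemma chunk_code_le N M t x y xr yr z z' : t <= k ->
  walk (in_slab N t) x y z -> walk (in_slab (N + M) t) (x + xr) (y + yr) z' ->
  size z' <= chunk_size (N + M) ->
  code_le_tag (chunk_code N t x y z) (chunk_code (N + M) t (x + xr) (y + yr) z') ->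
  exists2 r, interleave z r z' & 4 * G * N.+1 <= N + M -> yr + na r <= M * sumn qs ->
    walk (slab_ok qs M t) xr yr r.
Proof.
move=> tk Hu Hv Hsize [[Etag] /=]; rewrite /slope /= inordK // -Etag.
have Hpoint z1 r1 z1' z2 z2' : z = z1 ++ z2 -> z' = z1' ++ z2' -> interleave z1 r1 z1' ->
   [/\ in_slab N t (x + nb z1) (y + na z1), in_slab (N + M) t (x + xr + nb z1') (y + yr + na z1'),
    na z1' = na z1 + na r1, nb z1' = nb z1 + nb r1 &
    4 * (G * nb z1') <= N + M + 4 * G /\ 4 * na z1' <= N + M + 4 * G].
  move=> E E' H1; split; [exact: Hu E | exact: Hv E' | exact: interleave_na
    | exact: interleave_nb |].
  have := size_na_nb z1'; have : size z1' <= size z' by rewrite E' size_cat leq_addr.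
  move=> Hs Hs'; split; apply: leq_trans (chunk_size_bound Hsize).
    by rewrite !leq_mul2l; lia.
  by rewrite leq_mul2l /=; apply: leq_trans (leq_pmull _ G_gt0); lia.
have Hu0 := walk_start Hu; have Hv0 := walk_start Hv.
case Hty : near_ceil Etag => Etag /code_le [Hh [r Hr Hb]].
  exists r => // Hbig Htot r1 r2 Er; split; last first.
    have := Hb _ _ Er; case: Hu0 Hv0 => [[_ +] _] [[_ +] _].
    rewrite /ceil_ok /ceil_dist -/(q t.+1) -/(sm t.+1) ?(mulnDr, mulnDl); lia.
  have [q0|q0] := posnP (q t).
    by rewrite /floor_ok -/(q t) -/(sm t) (floor_vacuous tk q0) q0; lia.
  rewrite Er in Hr; have [z1 [z2 [z1' [z2' [Ez Ez' H1 _]]]]] := interleave_splitr Hr.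
  have [Hu1 Hv1 Ea Eb [HG _]] := Hpoint _ _ _ _ _ Ez Ez' H1.
  have [Hub _] := dist_bound Hu1.
  have Hfar : N + M <= 2 * floor_dist (N + M) t (x + xr) (y + yr).
    by move: Etag; rewrite /near_ceil eqn0Ngt q0 /=; case: (q t.+1 == 0).
  have Hq : q t * nb z1' <= G * nb z1' by rewrite leq_mul2r q_le_G orbT.
  case: Hu1 Hv0 Hv1 => [[+ _] _] [[+ _] _] [[+ _] _].
  move: Hub Hfar; rewrite /floor_ok /floor_dist -/(q t) -/(sm t).
  rewrite Ea Eb in HG Hq *; rewrite ?(mulnDr, mulnDl) in HG Hq *; lia.
have Hzr : interleave z (rev r) z' by rewrite -(revK z) -(revK z'); apply: interleave_rev.
exists (rev r) => // Hbig Htot r1 r2 Er.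
have Er' : r = rev r2 ++ rev r1 by rewrite -rev_cat -Er revK.
have Ea := interleave_na Hzr; have Eb := interleave_nb Hzr.
have Ear := congr1 na Er; have Ebr := congr1 nb Er; rewrite na_cat in Ear; rewrite nb_cat in Ebr.
split.
  have := Hb _ _ Er'; case: (walk_end Hu) (walk_end Hv) => [[+ _] _] [[+ _] _].
  rewrite rev_na rev_nb /floor_ok /floor_dist -/(q t) -/(sm t) Ea Eb Ear Ebr.
  by rewrite ?(mulnDr, mulnDl); lia.
have [q1|q1] := posnP (q t.+1).
  rewrite /ceil_ok -/(q t.+1) -/(sm t.+1) (ceil_vacuous tk q1) q1; lia.
rewrite Er in Hzr; have [z1 [z2 [z1' [z2' [Ez Ez' H1 _]]]]] := interleave_splitr Hzr.
have [Hu1 Hv1 Ea1 Eb1 [_ HG]] := Hpoint _ _ _ _ _ Ez Ez' H1.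
have [_ Hub] := dist_bound Hu1.
(* The floor is nearer than (N+M)/2 and the gap is at least N+M by [dist_large]. *)
have Hfar : N + M <= 2 * ceil_dist (N + M) t (x + xr) (y + yr).
  move: Etag; rewrite /near_ceil; have [q0|q0] := posnP (q t); first by [].
  rewrite eqn0Ngt q1 /= => /esym/negbT; rewrite -ltnNge.
  by have := dist_large Hv0 q0 q1; lia.
case: Hu1 Hv0 Hv1 => [[_ +] _] [[_ +] _] [[_ +] _].
move: Hub Hfar; rewrite /ceil_ok /ceil_dist -/(q t.+1) -/(sm t.+1).
by rewrite Ea1 Eb1 in HG *; rewrite ?(mulnDr, mulnDl) in HG *; lia.
Qed.

Fixpoint chunks_code N t x y zs :=
  if zs is z :: zs' then chunk_code N t x y z :: chunks_code N t (x + nb z) (y + na z) zs'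
  else [::].

Lemma size_chunks_code N t x y zs : size (chunks_code N t x y zs) = size zs.
Proof. by elim: zs x y => //= z zs IH x y; rewrite IH. Qed.

(** The induction starts from one chunk, which is what certifies the starting point of the
    remainder. *)
Lemma chunks_code_le N M t x y xr yr zs zs' : t <= k -> 0 < size zs ->
  walk (in_slab N t) x y (flatten zs) ->
  walk (in_slab (N + M) t) (x + xr) (y + yr) (flatten zs') ->
  all (fun z => size z <= chunk_size (N + M)) zs' ->
  forall2 code_le_tag (chunks_code N t x y zs) (chunks_code (N + M) t (x + xr) (y + yr) zs') ->
  exists2 r, interleave (flatten zs) r (flatten zs') &
    4 * G * N.+1 <= N + M -> yr + na r <= M * sumn qs -> walk (slab_ok qs M t) xr yr r.
Proof.
move=> tk; elim: zs zs' x y xr yr => [|z zs IH] [|z' zs'] x y xr yr //= _.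
move=> /walk_cat [Hu Hus] /walk_cat [Hv Hvs] /andP [Hs Hss] [Hz Hzs].
have [r Hr Hw] := chunk_code_le tk Hu Hv Hs Hz.
case: zs => [|z2 zs] in IH Hus Hzs *.
  by case: zs' Hzs {Hvs Hss} => //= _; exists r => //; rewrite !cats0.
have En : x + xr + nb z' = x + nb z + (xr + nb r) by rewrite (interleave_nb Hr); lia.
have Ea : y + yr + na z' = y + na z + (yr + na r) by rewrite (interleave_na Hr); lia.
rewrite En Ea in Hvs Hzs.
have [rs Hrs Hws] := IH _ _ _ _ _ isT Hus Hvs Hss Hzs.
exists (r ++ rs); first exact: interleave_cat.
move=> Hbig; rewrite na_cat => Htot; apply/walk_cat; split.
  by apply: Hw => //; lia.
by apply: Hws => //; lia.
Qed.

Fixpoint slabs_code N t y vs :=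
  if vs is v :: vs' then
    chunks_code N t (t * N) y (chop C (chunk_size N) v) :: slabs_code N t.+1 (y + na v) vs'
  else [::].

Lemma C_gt0 : 0 < C.
Proof.
have : 0 < size (block_word qs) by rewrite size_na_nb nb_block_word size_qs; lia.
by rewrite /C !muln_gt0 G_gt0 => ->.
Qed.

Lemma C_large N (v : word) : size v <= N * size (block_word qs) -> size v <= C * chunk_size N.
Proof.
move=> Hv; apply: (leq_trans Hv); rewrite /C /chunk_size mulnAC leq_mul2r; apply/orP; right.
have Hd := ltn_ceil N (_ : 0 < 4 * G); rewrite muln_gt0 G_gt0 in Hd.
by have := Hd isT; rewrite addn1 mulnC; apply: ltnW.
Qed.

Lemma walk_in_slab N t y v : nb v = N -> walk (slab_ok qs N t) (t * N) y v ->
  walk (in_slab N t) (t * N) y v.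
Proof.
move=> Hn Hw z1 z2 Ez; split; first exact: Hw Ez.
by have := congr1 nb Ez; rewrite nb_cat Hn; lia.
Qed.

Lemma slabs_code_le N M t y yr us vs : t + size us <= k.+1 ->
  slabs_ok qs N t y us -> slabs_ok qs (N + M) t (y + yr) vs ->
  all (fun u => size u <= C * chunk_size N) us -> all (fun v => size v <= C * chunk_size (N + M)) vs ->
  forall2 (forall2 code_le_tag) (slabs_code N t y us) (slabs_code (N + M) t (y + yr) vs) ->
  exists rs, [/\ size rs = size us, interleave (flatten us) (flatten rs) (flatten vs) &
    4 * G * N.+1 <= N + M -> yr + na (flatten rs) <= M * sumn qs -> slabs_ok qs M t yr rs].
Proof.
elim: us vs t y yr => [|u us IH] [|v vs] t y yr //=.
  by move=> _ _ _ _ _ _; exists [::]; split => //; apply: InterleaveNil.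
move=> Ht [Eu Hu Hus] [Ev Hv Hvs] /andP [Su Sus] /andP [Sv Svs] [Huv Huvs].
have Fu := flatten_chop Su; have Fv := flatten_chop Sv.
have Wu := walk_in_slab Eu Hu; have Wv := walk_in_slab Ev Hv.
rewrite -Fu in Wu; rewrite -Fv mulnDr in Wv; rewrite (mulnDr t) in Huv.
have [||r Hr Hw] := chunks_code_le _ _ Wu Wv (all_chop _ _ _) Huv; [lia | by rewrite size_chop C_gt0 |].
rewrite Fu Fv in Hr.
have Ea : y + yr + na v = y + na u + (yr + na r) by rewrite (interleave_na Hr); lia.
rewrite Ea in Hvs Huvs.
have [|rs [Srs Hrs Hok]] := IH _ _ _ _ _ Hus Hvs Sus Svs Huvs; first by rewrite addSnnS.
exists (r :: rs); split; [by rewrite /= Srs | exact: interleave_cat |].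
move=> Hbig /=; rewrite na_cat => Htot; split.
- by have := interleave_nb Hr; rewrite Eu Ev; lia.
- by apply: Hw => //; lia.
- by apply: Hok => //; lia.
Qed.

Lemma chunks_code_returns N t x y zs : t <= k -> walk (slab_ok qs N t) x y (flatten zs) ->
  forall1 (fun p => returns (code_weight (slope p.1)) 0 p.2) (chunks_code N t x y zs).
Proof.
move=> tk; elim: zs x y => //= z zs IH x y /walk_cat [Hz Hzs]; split; last exact: IH.
exact: chunk_code_returns.
Qed.

Lemma slabs_code_returns N t y vs : t + size vs <= k.+1 -> slabs_ok qs N t y vs ->
  all (fun v => size v <= C * chunk_size N) vs ->
  forall1 (fun s => size s = C /\
    forall1 (fun p => returns (code_weight (slope p.1)) 0 p.2) s) (slabs_code N t y vs).
Proof.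
elim: vs t y => //= v vs IH t y Ht [_ Hv Hvs] /andP [Sv Svs]; split.
  rewrite size_chunks_code size_chop; split=> //; apply: chunks_code_returns; first by lia.
  by rewrite flatten_chop.
by apply: IH => //; rewrite addSnnS.
Qed.

Lemma size_slabs_code N t y vs : size (slabs_code N t y vs) = size vs.
Proof. by elim: vs t y => //= v vs IH t y; rewrite IH. Qed.

Lemma all_flatten_size (vs : seq word) n : size (flatten vs) <= n ->
  all (fun v => size v <= n) vs.
Proof.
elim: vs => //= v vs IH; rewrite size_cat => H.
by rewrite IH ?andbT; lia.
Qed.

(** Either a later value reaches [F (N 0)], or the later values are bounded and one of them
    repeats. *)
Lemma equal_or_large (N : nat -> nat) (F : nat -> nat) :
  exists i j, i < j /\ (N i = N j \/ F (N i) <= N j).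
Proof.
have [[j Hj]|Hno] := classic (exists j, F (N 0) <= N j.+1).
  by exists 0, j.+1; split => //; right.
have Hlt j : N j.+1 < F (N 0) by rewrite ltnNge; apply/negP => H; apply: Hno; exists j.
have [g [g1 g2]] := @increasing_subsequences_fin _ (fun j => Ordinal (Hlt j)) (fun _ => I).
exists (g 0).+1, (g 1).+1; split; first by rewrite ltnS; apply: g1.
by left; have /(congr1 val) := g2 0 1 isT.
Qed.

Lemma plateau_well_copied_aux : well_copied (block_word qs).
Proof.
move=> f Hf.
have [N HN] := functional_choice _ Hf.
have [V HV] := functional_choice _ (fun n => copies_slabs Hqs size_qs (HN n)).
have Hsmall n : all (fun v => size v <= C * chunk_size (N n)) (V n).
  have [E _ _] := HV n; apply: sub_all (all_flatten_size (leqnn _)) => v Hv.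
  by apply: C_large; apply: leq_trans Hv _; rewrite -E (copies_size (HN n)).
have Hsub := @increasing_subsequences_seq _ _ _ k.+1 (@increasing_subsequences_seq _ _ _ C
  (@returns_subsequences _ _ (fun g => code_weight (slope g)))).
have [|g [g1 g2]] := Hsub (fun n => slabs_code (N n) 0 0 (V n)).
  move=> n; have [_ Sn On] := HV n; split; first by rewrite size_slabs_code.
  by apply: slabs_code_returns => //; rewrite Sn.
have [i [j [ij Hij]]] := equal_or_large (N \o g) (fun n => 4 * G * n.+1).
exists (g i), (g j); split; first exact: g1.
have NM : N (g j) = N (g i) + (N (g j) - N (g i)).
  case: Hij => [/= ->|/= H]; first by rewrite subnn addn0.
  rewrite subnKC //; apply: leq_trans H; rewrite mulnS.
  by have := leq_pmull (N (g i)) (_ : 0 < 4 * G); rewrite muln_gt0 G_gt0 => /(_ isT); lia.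
have [Ei Si Oi] := HV (g i); have [Ej Sj Oj] := HV (g j).
have := g2 _ _ ij; move: Oj (Hsmall (g j)); rewrite [in slabs_ok _ (N (g j))]NM
  [in chunk_size (N (g j))]NM [in slabs_code (N (g j))]NM => Oj Hj Hle.
have [|rs [Srs Hrs Hok]] := slabs_code_le (yr := 0) _ Oi Oj (Hsmall (g i)) Hj Hle.
  by rewrite Si.
(* With equally many copies the words have equal length, so the shuffle makes them equal; otherwise
   the remainder satisfies the slab conditions and is itself a shuffle of copies. *)
case: Hij => [/= Eij|/= Hbig].
  exists [::], 0; split; first exact: Copies0.
  rewrite -Ei -Ej in Hrs; rewrite -(interleave_eq Hrs); first exact: interleaves0.
  by rewrite (copies_size (HN (g i))) (copies_size (HN (g j))) Eij.
exists (flatten rs), (N (g j) - N (g i)); split; last by rewrite Ei Ej.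
have Ha : na (flatten rs) = (N (g j) - N (g i)) * sumn qs.
  have := interleave_na Hrs; rewrite -Ei -Ej (copies_na (HN (g i))) (copies_na (HN (g j))).
  by rewrite na_block_word {1}NM mulnDl; lia.
apply: (slabs_copies size_qs) => //; last by rewrite Srs.
by apply: Hok; rewrite -?NM // add0n Ha.
Qed.

End PlateauWords.

Lemma plateau_well_copied qs : plateau qs -> 1 < size qs -> well_copied (block_word qs).
Proof.
move=> Hqs Hs; have [k Ek] : exists k, size qs = k.+2 by exists (size qs - 2); lia.
(* The successor of the sum of the entries is positive and bounds each of them. *)
apply: (@plateau_well_copied_aux qs k Hqs Ek (sumn qs).+1) => // t.
elim: qs t {Hqs Hs Ek} => [|x s IH] [|t] //=; first by lia.
by have := IH t; lia.
Qed.

(** * Good words are plateau words up to exchanging letters *)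

Fixpoint doubled (c : letter) (w : word) : bool :=
  if w is x :: (y :: _) as w' then (x == c) && (y == c) || doubled c w' else false.

Lemma doubledP c w : doubled c w -> exists p s, w = p ++ [:: c; c] ++ s.
Proof.
elim: w => [|x [|y w] IH] //= /orP [/andP [/eqP -> /eqP ->]|H]; first by exists [::], w.
by have [p [s ->]] := IH H; exists (x :: p), s.
Qed.

Lemma doubled_mem c p s : doubled c (p ++ [:: c; c] ++ s).
Proof.
elim: p => [|x p IH] /=; first by rewrite eqxx.
by case: p IH => [|y p] /= ->; rewrite orbT.
Qed.

Lemma doubled_b_cat p s : doubled b (p ++ a :: s) = doubled b p || doubled b s.
Proof.
elim: p => [|x p IH] /=; first by case: s.
by case: p IH => [|y p] /= ->; rewrite ?andbF // orbA.
Qed.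

(** Reading on from aa, one meets aabb or aabab, both bad, or else a later aa closer to the final
    bb. *)
Lemma aa_bb_bad_factor p q s : has_bad_factor (p ++ [:: a; a] ++ q ++ [:: b; b] ++ s).
Proof.
have [n] := ubnP (size q); elim: n p q => // n IH p [|[] q] /= Hn.
- by left; exists 2, 2; split => //; split => //; exists p, s.
- have := IH (rcons p a) q _; rewrite cat_rcons; apply; lia.
case: q Hn => [|[] q] Hn.
- by left; exists 2, 2; split => //; split => //; exists p, (b :: s).
- case: q Hn => [|[] q] /= Hn.
  + by right; exists 2, 1, 1; do 3!split => //; exists p, (b :: s).
  + have := IH (p ++ [:: a; a; b]) q _; rewrite -!catA /=; apply; lia.
  + by right; exists 2, 1, 1; do 3!split => //; exists p, (q ++ b :: b :: s).
- by left; exists 2, 2; split => //; split => //; exists p, (q ++ b :: b :: s).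
Qed.

Lemma doubled_bad w : doubled a w -> doubled b w -> bad w.
Proof.
move=> /doubledP [p [s Ew]].
rewrite Ew (doubled_b_cat p) (doubled_b_cat [::]) => /orP [/doubledP|/doubledP].
  move=> [p' [q Ep]]; right; right; left.
  by rewrite Ep /E !map_cat -!catA; apply: aa_bb_bad_factor.
by move=> [q [s' ->]]; left; apply: aa_bb_bad_factor.
Qed.

Lemma doubled_E w : doubled b (E w) = doubled a w.
Proof. by elim: w => [|x [|y w] IH] //=; move: IH => /= ->; case: x; case: y. Qed.

Lemma bad_E w : bad (E w) -> bad w.
Proof.
rewrite /bad E_involutive; have -> : rev (E w) = E (rev w) by rewrite /E map_rev.
by rewrite E_involutive; tauto.
Qed.

Lemma block_word_exists w : exists2 qs, 0 < size qs & w = block_word qs.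
Proof.
elim: w => [|[] w [[|q qs] // _ ->]]; first by exists [:: 0].
  by exists (q.+1 :: qs) => //; case: qs.
by exists [:: 0, q & qs].
Qed.

Lemma block_word_three t qs : t.+2 < size qs -> exists p s, block_word qs =
  p ++ nseq (nth 0 qs t) a ++ b :: nseq (nth 0 qs t.+1) a ++ b :: nseq (nth 0 qs t.+2) a ++ s.
Proof.
elim: t qs => [|t IH] [|x [|y qs]] //.
  case: qs => [|z qs] // _; exists [::]; case: qs => [|u qs]; first by exists [::]; rewrite /= cats0.
  by exists (b :: block_word (u :: qs)).
move=> Ht; have [p [s Es]] := IH (y :: qs) Ht.
by exists (nseq x a ++ b :: p), s; rewrite -catA cat_cons -Es.
Qed.

(** Without bb the inner blocks are nonempty, so an inner block shorter than its left neighbour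
    gives a bad factor with m = 1; for the right neighbour the reversed word is used. *)
Lemma good_plateau w qs : good w -> ~~ doubled b w -> w = block_word qs -> plateau qs.
Proof.
move=> Hw Hb Ew t Ht; have [p [s Es]] := block_word_three Ht; rewrite -Ew in Es.
have Hpos : 0 < nth 0 qs t.+1.
  rewrite lt0n; apply: contra Hb => /eqP E0.
  by rewrite Es E0 (catA p) /=; apply: doubled_mem.
split; rewrite leqNgt; apply/negP => Hlt; apply: Hw.
  left; right; exists (nth 0 qs t), (nth 0 qs t.+1), 1; do 3!split => //.
  by exists p, (nseq (nth 0 qs t.+2) a ++ s); rewrite Es /= -!catA /= -catA.
right; left; right; exists (nth 0 qs t.+2), (nth 0 qs t.+1), 1; do 3!split => //.
exists (rev s), (rev (p ++ nseq (nth 0 qs t) a)).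
by rewrite Es catA !(rev_cat, rev_cons) !rev_nseq -!cats1 -!catA.
Qed.

Lemma well_copied_nil : well_copied [::].
Proof.
move=> s Hs; exists 0, 1; split => //; exists [::], 0; split; first exact: Copies0.
have Hnil i : s i = [::].
  by have [m /copies_size] := Hs i; rewrite muln0 => /size0nil.
by rewrite !Hnil; apply: InterleaveNil.
Qed.

Lemma good_well_copied_aux w : good w -> ~~ doubled b w -> well_copied w.
Proof.
move=> Hw Hb; have [qs Hqs Ew] := block_word_exists w.
have Hpl := good_plateau Hw Hb Ew.
case: qs Hqs Hpl Ew => [|q [|q' qs]] // _ Hpl ->; last exact: plateau_well_copied.
case: q {Hpl} => [|q] /=; first exact: well_copied_nil.
(* A power of a has a single block, but the plateau lemma needs two: exchanging letters turns it
   into a power of b, with [q.+2] empty blocks. *)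
have -> : a :: nseq q a = E (block_word (nseq q.+2 0)).
  by elim: q => //= q ->.
by apply/well_copied_E/plateau_well_copied => // t _; rewrite !nth_nseq !if_same.
Qed.

Lemma good_well_copied w : good w -> well_copied w.
Proof.
move=> Hw; have [Hb|Hb] := boolP (doubled b w); last exact: good_well_copied_aux.
rewrite -[w]E_involutive; apply/well_copied_E/good_well_copied_aux.
  by move/bad_E.
by rewrite doubled_E; apply/negP => Ha; apply: Hw; apply: doubled_bad.
Qed.

Theorem theorem1 (w : word) :
  wqo_on (L_eps (fun u => u = w)) (derives (fun u => u = w)) <-> good w.
Proof.
rewrite wqo_onP; split=> [Hw Hbad|]; first exact: bad_not_well_copied Hbad Hw.
exact: good_well_copied.
Qed.
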